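(* Let $m\ge 2$ and $0\le s\le m$, $k\in\mathbb{N}_0$. Put $$\mathcal{I}_k^s=\mathrm{Ker}_k^s\underline{\partial}^+\oplus\big(\mathrm{Ker}_k^{s-1}\underline{\partial}^-\big)e_m .$$ (i) The Cauchy–Kovalevskaya extension operator $CK$ restricts to a linear isomorphism of $\mathcal{I}_k^s$ onto $\mathcal{H}_k^s(\mathbb{R}^m)$, and this isomorphism intertwines the H-action of $Pin(m-1)$. (ii) Moreover, if $u_0\in\mathrm{Ker}_k^s\underline{\partial}^+$ and $v_0\in\mathrm{Ker}_k^{s-1}\underline{\partial}^-$, then $$CK(u_0+v_0e_m)(\underline{\mathbf{x}},x_m)=\sum_{j=0}^k\frac{x_m^j}{j!}u_j(\underline{\mathbf{x}})+\sum_{j=0}^k\frac{x_m^j}{j!}v_j(\underline{\mathbf{x}})e_m,$$ where for $t\ge 0$ $$u_{2t}=(\underline{\partial}^+\underline{\partial}^-)^tu_0,\quad u_{2t+1}=(-1)^{s-1}(\underline{\partial}^+\underline{\partial}^-)^t\underline{\partial}^+v_0,$$ $$v_{2t}=(\underline{\partial}^-\underline{\partial}^+)^tv_0,\quad v_{2t+1}=(-1)^{s-1}(\underline{\partial}^-\underline{\partial}^+)^t\underline{\partial}^-u_0.$$ In addition, for every $p\in\mathcal{H}_k^s(\mathbb{R}^m)$, its restriction $p_0(\underline{\mathbf x})=p(\underline{\mathbf x},0)$ lies in $\mathcal I_k^s$ and $p=CK(p_0)$.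
   Context: $\mathcal{C}\ell_m$ denotes either the real Clifford algebra $\mathbb{R}_{0,m}$ or the complex Clifford algebra $\mathbb{C}_m$ generated by the standard basis $e_1,\dots,e_m$ of $\mathbb{R}^m$ with relations $e_ie_j+e_je_i=-2\delta_{ij}$; $\mathcal{C}\ell_m=\bigoplus_{s=0}^m\mathcal{C}\ell_m^s$, where $\mathcal{C}\ell_m^s$ is the space of $s$-vectors (spanned by the products $e_{i_1}\cdots e_{i_s}$, $i_1<\dots<i_s$). A point $\mathbf{x}=(x_1,\dots,x_m)$ is identified with the 1-vector $\sum_j x_je_j$. For a 1-vector $u$ and an $s$-vector $v$, $u\bullet v=\frac12(uv-(-1)^svu)$ and $u\wedge v=\frac12(uv+(-1)^svu)$, extended linearly in $v$. $\mathcal P_k^s(\mathbb R^m)$ is the space of $k$-homogeneous $\mathcal C\ell_m^s$-valued polynomials on $\mathbb R^m$ (zero if $k<0$ or $s\notin\{0,\dots,m\}$); $\mathcal{H}_k^s(\mathbb R^m)=\{P\in\mathcal{P}_k^s(\mathbb R^m):\partial P=0\}$ where $\partial=\sum_{j=1}^m e_j\partial_{x_j}$ acts from the left. The H-action of $Pin(m)$ on polynomials is $[H(r)P](\mathbf x)=rP(r^{-1}\mathbf x r)r^{-1}$; $Pin(m-1)\subset Pin(m)$ is generated by unit vectors in $\mathrm{span}(e_1,\dots,e_{m-1})$. Write $\underline{\mathbf{x}}=\sum_{j=1}^{m-1}x_je_j$, $\underline{\partial}=\sum_{j=1}^{m-1}e_j\partial_{x_j}$, $\underline{\partial}^+P=\sum_{j=1}^{m-1}e_j\wedge\partial_{x_j}P$,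 $\underline{\partial}^-P=\sum_{j=1}^{m-1}e_j\bullet\partial_{x_j}P$. $\mathcal{P}_k^s(\mathbb{R}^{m-1})$ denotes the $k$-homogeneous polynomials in $x_1,\dots,x_{m-1}$ with values in the $s$-vectors of the subalgebra $\mathcal{C}\ell_{m-1}$ generated by $e_1,\dots,e_{m-1}$, and $\mathrm{Ker}_k^s\underline{\partial}^{\pm}=\{u\in\mathcal{P}_k^s(\mathbb{R}^{m-1}):\underline{\partial}^{\pm}u=0\}$ (zero if $s<0$ or $s>m-1$). For a $\mathcal{C}\ell_m$-valued polynomial $p_0$ in $\underline{\mathbf x}$, the Cauchy–Kovalevskaya extension is $CK(p_0)(\underline{\mathbf{x}},x_m)=\sum_{j\ge 0}\frac{x_m^j}{j!}(e_m\underline{\partial})^jp_0(\underline{\mathbf{x}})$ (formally $e^{e_mx_m\underline\partial}p_0$). *)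

(* Defs.v *)
From HB Require Import structures.
From mathcomp Require Import all_boot all_order all_algebra.
Set Implicit Arguments. Unset Strict Implicit. Unset Printing Implicit Defensive.
Import Order.TTheory GRing.Theory Num.Theory.
Local Open Scope ring_scope.

(* Clifford algebra Cl_m over scalars F: coefficients on basis blades e_A,
   A a subset of {0..m-1} (e_A = e_{i1}...e_{is}, i1<...<is). *)
Notation Cl F m := {ffun {set 'I_m} -> F}.
Notation mi m := {ffun 'I_m -> nat}.
(* Cl_m-valued polynomials (power series) in x_1..x_m, by coefficients:
   P al is the coefficient of x^al. *)
Notation cpoly F m := (mi m -> Cl F m).

Definition blade {F : numFieldType} {m : nat} (C : {set 'I_m}) : Cl F m :=
  [ffun D : {set 'I_m} => (D == C)%:R].
Definition vec {F : numFieldType} {m : nat} (j : 'I_m) : Cl F m := blade [set j].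
Definition clscale {F : numFieldType} {m : nat} (c : F) (a : Cl F m) : Cl F m :=
  [ffun A : {set 'I_m} => c * a A].
Definition clone {F : numFieldType} {m : nat} : Cl F m := blade set0.

(* e_A e_B = (-1)^(inversions + |A cap B|) e_{A sym-diff B}, from e_ie_j+e_je_i=-2delta_ij *)
Definition clsign {F : numFieldType} {m : nat} (A B : {set 'I_m}) : F :=
  (-1) ^+ (#|[set p : 'I_m * 'I_m | (p.1 \in A) && (p.2 \in B) && (p.2 < p.1)%N]|
           + #|A :&: B|)%N.

Definition clmul {F : numFieldType} {m : nat} (a b : Cl F m) : Cl F m :=
  \sum_(A : {set 'I_m}) \sum_(B : {set 'I_m})
     clscale (a A * b B * clsign A B) (blade ((A :\: B) :|: (B :\: A))).

Definition gproj {F : numFieldType} {m : nat} (s : nat) (a : Cl F m) : Cl F m :=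
  [ffun A : {set 'I_m} => if #|A| == s then a A else 0].
(* a is an s-vector (s an integer; for s < 0 this forces a = 0) *)
Definition is_grade {F : numFieldType} {m : nat} (s : int) (a : Cl F m) : Prop :=
  forall A, a A != 0 -> (#|A|%:Z = s).

Definition dotv {F : numFieldType} {m : nat} (u v : Cl F m) : Cl F m :=
  \sum_(s < m.+1) clscale (2%:R^-1)
     (clmul u (gproj s v) - clscale ((-1) ^+ s) (clmul (gproj s v) u)).
Definition wedgev {F : numFieldType} {m : nat} (u v : Cl F m) : Cl F m :=
  \sum_(s < m.+1) clscale (2%:R^-1)
     (clmul u (gproj s v) + clscale ((-1) ^+ s) (clmul (gproj s v) u)).

(* the last index m-1 (0-based), i.e. e_m of the paper *)
Definition lastset (m : nat) : {set 'I_m} := [set i : 'I_m | val i == m.-1].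
Definition em {F : numFieldType} {m : nat} : Cl F m := blade (lastset m).
Definition low {m : nat} (i : 'I_m) : bool := (val i < m.-1)%N.
Definition alast {m : nat} (al : mi m) : nat := (\sum_(i : 'I_m | val i == m.-1) al i)%N.
Definition shiftm {m : nat} (j : nat) (al : mi m) : mi m :=
  [ffun i => if val i == m.-1 then (al i - j)%N else al i].

Definition pderiv {F : numFieldType} {m : nat} (j : 'I_m) (P : cpoly F m) : cpoly F m :=
  fun al => clscale (al j).+1%:R (P [ffun i => (al i + (i == j))%N]).
Definition dirac {F : numFieldType} {m : nat} (P : cpoly F m) : cpoly F m :=
  fun al => \sum_(j : 'I_m) clmul (vec j) (pderiv j P al).
Definition dunder {F : numFieldType} {m : nat} (P : cpoly F m) : cpoly F m :=
  fun al => \sum_(j : 'I_m | low j) clmul (vec j) (pderiv j P al).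
Definition dplus {F : numFieldType} {m : nat} (P : cpoly F m) : cpoly F m :=
  fun al => \sum_(j : 'I_m | low j) wedgev (vec j) (pderiv j P al).
Definition dminus {F : numFieldType} {m : nat} (P : cpoly F m) : cpoly F m :=
  fun al => \sum_(j : 'I_m | low j) dotv (vec j) (pderiv j P al).

Definition homog {F : numFieldType} {m : nat} (k : nat) (P : cpoly F m) : Prop :=
  forall al : mi m, P al != 0 -> (\sum_i al i)%N = k.
Definition pgrade {F : numFieldType} {m : nat} (s : int) (P : cpoly F m) : Prop :=
  forall al, is_grade s (P al).
Definition lowvar {F : numFieldType} {m : nat} (P : cpoly F m) : Prop :=
  forall (al : mi m) (i : 'I_m), val i = m.-1 -> al i != 0%N -> P al = 0.
Definition lowalg {F : numFieldType} {m : nat} (P : cpoly F m) : Prop :=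
  forall (al : mi m) (A : {set 'I_m}) (i : 'I_m), i \in A -> val i = m.-1 -> P al A = 0.

Definition Pks {F : numFieldType} {m : nat} (k : nat) (s : int) (P : cpoly F m) : Prop :=
  homog k P /\ pgrade s P.
Definition Hks {F : numFieldType} {m : nat} (k : nat) (s : int) (P : cpoly F m) : Prop :=
  Pks k s P /\ (forall al, dirac P al = 0).
Definition Pks_low {F : numFieldType} {m : nat} (k : nat) (s : int) (P : cpoly F m) : Prop :=
  Pks k s P /\ lowvar P /\ lowalg P.
Definition Kerplus {F : numFieldType} {m : nat} (k : nat) (s : int) (P : cpoly F m) : Prop :=
  Pks_low k s P /\ (forall al, dplus P al = 0).
Definition Kerminus {F : numFieldType} {m : nat} (k : nat) (s : int) (P : cpoly F m) : Prop :=
  Pks_low k s P /\ (forall al, dminus P al = 0).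

Definition padd {F : numFieldType} {m : nat} (P Q : cpoly F m) : cpoly F m :=
  fun al => P al + Q al.
Definition pscale {F : numFieldType} {m : nat} (c : F) (P : cpoly F m) : cpoly F m :=
  fun al => clscale c (P al).
Definition prmul {F : numFieldType} {m : nat} (P : cpoly F m) (a : Cl F m) : cpoly F m :=
  fun al => clmul (P al) a.

Definition Ispace {F : numFieldType} {m : nat} (k s : nat) (p0 : cpoly F m) : Prop :=
  exists u0 v0, Kerplus k s u0 /\ Kerminus k (s%:Z - 1) v0 /\
                p0 = padd u0 (prmul v0 em).

Definition mulxm {F : numFieldType} {m : nat} (j : nat) (P : cpoly F m) : cpoly F m :=
  fun al => if (j <= alast al)%N then P (shiftm j al) else 0.

Definition emd_iter {F : numFieldType} {m : nat} (j : nat) (p0 : cpoly F m) : cpoly F m :=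
  iter j (fun Q => fun al => clmul em (dunder Q al)) p0.

(* CK(p0) = sum_j x_m^j/j! (e_m dunder)^j p0, coefficientwise (finite for each al) *)
Definition CK {F : numFieldType} {m : nat} (p0 : cpoly F m) : cpoly F m :=
  fun al => \sum_(j < (alast al).+1) clscale (j`!%:R)^-1 (mulxm j (emd_iter j p0) al).

Definition series {F : numFieldType} {m : nat} (k : nat) (u : nat -> cpoly F m) : cpoly F m :=
  fun al => \sum_(j < k.+1) clscale (j`!%:R)^-1 (mulxm j (u j) al).

Definition pmd {F : numFieldType} {m : nat} (P : cpoly F m) : cpoly F m := dplus (dminus P).
Definition mdp {F : numFieldType} {m : nat} (P : cpoly F m) : cpoly F m := dminus (dplus P).

(* u_n and v_n; note (-1)^(s-1) = (-1)^(s+1) *)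
Definition useq {F : numFieldType} {m : nat} (s : nat) (u0 v0 : cpoly F m) (n : nat) : cpoly F m :=
  if odd n then pscale ((-1) ^+ s.+1) (iter n./2 pmd (dplus v0))
  else iter n./2 pmd u0.
Definition vseq {F : numFieldType} {m : nat} (s : nat) (u0 v0 : cpoly F m) (n : nat) : cpoly F m :=
  if odd n then pscale ((-1) ^+ s.+1) (iter n./2 mdp (dminus u0))
  else iter n./2 mdp v0.

Definition restr {F : numFieldType} {m : nat} (p : cpoly F m) : cpoly F m :=
  fun al => if alast al == 0%N then p al else 0.

(* evaluation of a k-homogeneous polynomial at x in F^m *)
Definition peval {F : numFieldType} {m : nat} (k : nat) (P : cpoly F m) (x : 'I_m -> F) : Cl F m :=
  \sum_(a : {ffun 'I_m -> 'I_k.+1} | (\sum_i (a i : nat))%N == k)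
     clscale (\prod_i x i ^+ a i) (P [ffun i => val (a i)]).
Definition xvec {F : numFieldType} {m : nat} (x : 'I_m -> F) : Cl F m :=
  \sum_j clscale (x j) (vec j).
Definition coords {F : numFieldType} {m : nat} (c : Cl F m) : 'I_m -> F :=
  fun j => c [set j].

Definition unitlow {F : numFieldType} {m : nat} (c : 'I_m -> F) : Prop :=
  (forall j, c j \is Num.real) /\ (forall j, ~~ low j -> c j = 0) /\
  \sum_j c j ^+ 2 = 1.
Definition pin_low {F : numFieldType} {m : nat} (r : Cl F m) : Prop :=
  exists cs : seq ('I_m -> F), (forall i, (i < size cs)%N -> unitlow (nth (fun _ => 0) cs i)) /\
    r = foldr (fun c acc => clmul (xvec c) acc) clone cs.

Definition hact_at {F : numFieldType} {m : nat} (k : nat) (r rinv : Cl F m) (P : cpoly F m)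
  (x : 'I_m -> F) : Cl F m :=
  clmul (clmul r (peval k P (coords (clmul (clmul rinv (xvec x)) r)))) rinv.

(* Main.v *)
Require Import Defs.
From HB Require Import structures.
From mathcomp Require Import all_boot all_algebra.
From mathcomp Require Import boolp functions.
From mathcomp Require Import ring zify.
Set Implicit Arguments. Unset Strict Implicit. Unset Printing Implicit Defensive.
Import GRing.Theory Num.Theory.
Local Open Scope ring_scope.

(** The CK extension of [p0] is the only solution of [dirac p = 0] with [p = p0] on
    [x_m = 0]: the coefficient of [x_m^(j+1)] is forced to be [e_m dunder] applied to that
    of [x_m^j], up to a factorial.  For [u] and [v] free of [e_m], of grades [s] and [s - 1],
    [e_m dunder (u + v e_m) = (-1)^(s-1) (dunder v + (dunder u) e_m)], whose parts of grade
    other than [s] are [dminus v] and [(dplus u) e_m]; so this is an [s]-vector exactly when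
    [dplus u = 0] and [dminus v = 0].  Since [dplus] and [dminus] square to zero, these two
    conditions persist along the expansion, which also gives the explicit formula.

    For the Pin action, [x |-> r^-1 x r] is an orthogonal map [L] preserving the last axis up
    to a scalar.  By the chain rule [dunder] commutes with the H-action, and the scalar
    produced by moving [r] past [e_m] is compensated by the action on [x_m]. *)

(** * The Clifford algebra *)

Section SymmetricDifference.
Variable T : finType.
Implicit Types A B C : {set T}.

Definition symdiff A B := (A :\: B) :|: (B :\: A).

Lemma in_symdiff A B i : (i \in symdiff A B) = (i \in A) (+) (i \in B).
Proof. by rewrite !inE; case: (i \in A); case: (i \in B). Qed.

Lemma symdiffC : commutative symdiff.
Proof. by move=> A B; apply/setP=> i; rewrite !in_symdiff addbC. Qed.

Lemma symdiffA : associative symdiff.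
Proof. by move=> A B C; apply/setP=> i; rewrite !in_symdiff addbA. Qed.

Lemma symdiffs0 : right_id set0 symdiff.
Proof. by move=> A; apply/setP=> i; rewrite in_symdiff inE addbF. Qed.

Lemma symdiffss A : symdiff A A = set0.
Proof. by apply/setP=> i; rewrite in_symdiff addbb inE. Qed.

Lemma symdiffK A : involutive (symdiff A).
Proof. by move=> B; rewrite symdiffA symdiffss symdiffC symdiffs0. Qed.

Lemma symdiff_eq A B C : (symdiff A B == C) = (B == symdiff A C).
Proof. by rewrite -(inj_eq (inv_inj (symdiffK A))) symdiffK. Qed.

Lemma card_symdiff1 A j : #|symdiff [set j] A| = if j \in A then #|A|.-1 else #|A|.+1.
Proof.
case: ifPn => jA.
  have -> : symdiff [set j] A = A :\ j.
    by apply/setP=> i; rewrite in_symdiff !inE; case: eqP => // ->; rewrite jA.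
  by rewrite (cardsD1 j A) jA.
have -> : symdiff [set j] A = j |: A.
  by apply/setP=> i; rewrite in_symdiff !inE; case: eqP => // ->; rewrite (negPf jA).
by rewrite cardsU1 jA.
Qed.

End SymmetricDifference.

Section BladeSign.
Variables (F : numFieldType) (m : nat).
Implicit Types (A B C : {set 'I_m}) (i j : 'I_m).

Lemma clsign_prod A B :
  clsign A B = \prod_i \prod_j (-1) ^+ [&& i \in A, j \in B & (j <= i)%N] :> F.
Proof.
rewrite /clsign exprD -!prodr_const.
rewrite (eq_bigl (fun p => true && [&& p.1 \in A, p.2 \in B & (p.2 < p.1)%N])); last first.
  by move=> p; rewrite inE -andbA.
rewrite [X in _ * X](big_mkcond (mem (A :&: B))) big_mkcondr /=.
rewrite -(pair_bigA _ (fun i j => if [&& i \in A, j \in B & (j < i)%N] then -1 else 1)) /=.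
rewrite -big_split /=; apply: eq_bigr => i _.
rewrite (bigD1 i) //= [RHS](bigD1 i) //= ltnn leqnn !andbF andbT mul1r mulrC; congr (_ * _).
  by rewrite inE; case: (_ && _).
apply: eq_bigr => j ji; rewrite (leq_eqVlt j) val_eqE (negPf ji) /=.
by case: [&& _, _ & _].
Qed.

Lemma clsign_symdiffl A B C : clsign (symdiff A B) C = clsign A C * clsign B C :> F.
Proof.
rewrite !clsign_prod -big_split; apply: eq_bigr => i _ /=.
rewrite -big_split; apply: eq_bigr => j _ /=; rewrite -signr_addb in_symdiff.
by case: (i \in A); case: (i \in B); case: (j \in C); case: (_ <= _)%N.
Qed.

Lemma clsign_symdiffr A B C : clsign A (symdiff B C) = clsign A B * clsign A C :> F.
Proof.
rewrite !clsign_prod -big_split; apply: eq_bigr => i _ /=.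
rewrite -big_split; apply: eq_bigr => j _ /=; rewrite -signr_addb in_symdiff.
by case: (i \in A); case: (j \in B); case: (j \in C); case: (_ <= _)%N.
Qed.

Lemma clsign0l A : clsign set0 A = 1 :> F.
Proof. by rewrite clsign_prod big1 // => i _; rewrite big1 // => j _; rewrite inE. Qed.

Lemma clsign0r A : clsign A set0 = 1 :> F.
Proof. by rewrite clsign_prod big1 // => i _; rewrite big1 // => j _; rewrite inE andbF. Qed.

Lemma clsign1l j A : clsign [set j] A = \prod_(i in A) (-1) ^+ (i <= j)%N :> F.
Proof.
rewrite clsign_prod (bigD1 j) //= [X in _ * X]big1 ?mulr1; last first.
  by move=> i ij; rewrite big1 // => l _; rewrite inE (negPf ij).
rewrite [RHS]big_mkcond; apply: eq_bigr => i _; rewrite inE eqxx /=.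
by case: (i \in A).
Qed.

Lemma clsign1r j A : clsign A [set j] = \prod_(i in A) (-1) ^+ (j <= i)%N :> F.
Proof.
rewrite clsign_prod [RHS]big_mkcond; apply: eq_bigr => i _.
rewrite (bigD1 j) //= big1 ?mulr1; last by move=> l lj; rewrite inE (negPf lj) /= andbF.
by rewrite inE eqxx /=; case: (i \in A).
Qed.

Lemma clsign11 j : clsign [set j] [set j] = -1 :> F.
Proof. by rewrite clsign1l big_set1 leqnn. Qed.

Lemma clsign1C j A :
  clsign A [set j] = (-1) ^+ (#|A| + (j \in A)) * clsign [set j] A :> F.
Proof.
have -> : (-1) ^+ (#|A| + (j \in A)) = \prod_(i in A) - (-1) ^+ (i == j) :> F.
  rewrite exprD prodrN; congr (_ * _).
  case: (boolP (j \in A)) => jA; last first.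
    by rewrite big1 // => i iA; case: eqP => // ij; rewrite -ij iA in jA.
  by rewrite (bigD1 j) //= eqxx big1 ?mulr1 // => i /andP[_ /negPf->].
rewrite clsign1l clsign1r -big_split; apply: eq_bigr => i iA /=.
by rewrite -val_eqE /=; case: ltngtP; rewrite ?mulNr ?mul1r ?opprK.
Qed.

End BladeSign.

(* A copy of [Cl F m], since finite functions already carry the pointwise product. *)
Definition clifford (F : numFieldType) (m : nat) : Type := Cl F m.

HB.instance Definition _ (F : numFieldType) (m : nat) :=
  GRing.Zmodule.copy (clifford F m) (Cl F m).

Section CliffordAlgebra.
Variables (F : numFieldType) (m : nat).
Implicit Types (A B C D : {set 'I_m}) (a b c : clifford F m) (x y : F).

Lemma clmul_coef a b C :
  clmul a b C = \sum_A a A * b (symdiff A C) * clsign A (symdiff A C).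
Proof.
rewrite /clmul sum_ffunE; apply: eq_bigr => A _.
rewrite sum_ffunE (bigD1 (symdiff A C)) //= big1 ?addr0; last first.
  move=> B; rewrite -symdiff_eq eq_sym !ffunE => /negPf.
  by rewrite -/(symdiff A B) => ->; rewrite mulr0.
by rewrite !ffunE -/(symdiff A _) symdiffK eqxx mulr1.
Qed.

Fact clscaleA x y a : clscale x (clscale y a) = clscale (x * y) a.
Proof. by apply/ffunP=> A; rewrite !ffunE mulrA. Qed.

Fact clscale1 : left_id 1 (@clscale F m).
Proof. by move=> a; apply/ffunP=> A; rewrite !ffunE mul1r. Qed.

Fact clscaleDr : right_distributive (@clscale F m) +%R.
Proof. by move=> x a b; apply/ffunP=> A; rewrite !ffunE mulrDr. Qed.

Fact clscaleDl a : {morph clscale^~ a : x y / x + y}.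
Proof. by move=> x y; apply/ffunP=> A; rewrite !ffunE mulrDl. Qed.

HB.instance Definition _ := GRing.Zmodule_isLmodule.Build F (clifford F m)
  clscaleA clscale1 clscaleDr clscaleDl.

Fact clmulA : associative (@clmul F m).
Proof.
move=> a b c; apply/ffunP=> D; rewrite !clmul_coef.
under [RHS]eq_bigr => B _ do rewrite clmul_coef !mulr_suml.
rewrite exchange_big; apply: eq_bigr => A _ /=.
rewrite clmul_coef mulr_sumr mulr_suml (reindex_inj (inv_inj (symdiffK A))).
apply: eq_bigr => B _ /=.
have -> : symdiff (symdiff A B) (symdiff A D) = symdiff B D.
  by rewrite [symdiff A B]symdiffC -symdiffA symdiffK.
have -> : symdiff A D = symdiff (symdiff A B) (symdiff B D).
  by rewrite -symdiffA symdiffK.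
set A' := symdiff A B; set B' := symdiff B D.
have -> : clsign B B' = clsign A B' * clsign A' B' :> F by rewrite -clsign_symdiffl symdiffK.
rewrite clsign_symdiffr; ring.
Qed.

Fact clmul1 : left_id clone (@clmul F m).
Proof.
move=> a; apply/ffunP=> C; rewrite clmul_coef (bigD1 set0) //= big1 => [|A /negPf A0].
  by rewrite ffunE eqxx mul1r addr0 symdiffC symdiffs0 clsign0l mulr1.
by rewrite ffunE A0 !mul0r.
Qed.

Fact clmul1r : right_id clone (@clmul F m).
Proof.
move=> a; apply/ffunP=> C; rewrite clmul_coef (bigD1 C) //= big1 => [|A].
  by rewrite ffunE symdiffss eqxx addr0 clsign0r !mulr1.
by rewrite eq_sym ffunE symdiff_eq symdiffs0 => /negPf->; rewrite mulr0 mul0r.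
Qed.

Fact clmulDl : left_distributive (@clmul F m) +%R.
Proof.
move=> a b c; apply/ffunP=> C; rewrite ffunE !clmul_coef -big_split.
by apply: eq_bigr => A _; rewrite ffunE !mulrDl.
Qed.

Fact clmulDr : right_distributive (@clmul F m) +%R.
Proof.
move=> a b c; apply/ffunP=> C; rewrite ffunE !clmul_coef -big_split.
by apply: eq_bigr => A _; rewrite ffunE mulrDr !mulrDl.
Qed.

Fact clone_neq0 : clone != 0 :> clifford F m.
Proof. by apply/eqP=> /ffunP/(_ set0); rewrite !ffunE eqxx; apply/eqP/oner_neq0. Qed.

HB.instance Definition _ := GRing.Zmodule_isNzRing.Build (clifford F m)
  clmulA clmul1 clmul1r clmulDl clmulDr clone_neq0.

Fact clscaleAl x a b : x *: (a * b) = x *: a * b.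
Proof.
apply/ffunP=> C; rewrite ffunE !clmul_coef mulr_sumr.
by apply: eq_bigr => A _; rewrite ffunE !mulrA.
Qed.

HB.instance Definition _ :=
  GRing.Lmodule_isLalgebra.Build F (clifford F m) clscaleAl.

Fact clscaleAr x a b : x *: (a * b) = a * (x *: b).
Proof.
apply/ffunP=> C; rewrite ffunE !clmul_coef mulr_sumr.
by apply: eq_bigr => A _; rewrite ffunE !mulrA [x * _]mulrC.
Qed.

HB.instance Definition _ :=
  GRing.Lalgebra_isAlgebra.Build F (clifford F m) clscaleAr.

End CliffordAlgebra.

Definition gen {F : numFieldType} {m : nat} (j : 'I_m) : clifford F m := vec j.

Definition vector {F : numFieldType} {m : nat} (x : 'I_m -> F) : clifford F m := xvec x.

Section Generators.
Variables (F : numFieldType) (m : nat).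
Implicit Types (A B C : {set 'I_m}) (a b : clifford F m) (i j : 'I_m) (x y : 'I_m -> F).

Lemma clmulE a b : clmul a b = a * b. Proof. by []. Qed.

Lemma clscaleE (c : F) a : clscale c a = c *: a. Proof. by []. Qed.

Lemma coef_scale (c : F) a A : (c *: a) A = c * a A. Proof. exact: ffunE. Qed.

Lemma vectorE x : vector x = \sum_j x j *: gen j. Proof. by []. Qed.

Lemma coef_gen_mul j a C :
  (gen j * a) C = clsign [set j] (symdiff [set j] C) * a (symdiff [set j] C).
Proof.
rewrite -clmulE clmul_coef (bigD1 [set j]) //= big1 => [|A /negPf Aj].
  by rewrite ffunE eqxx addr0 mul1r mulrC.
by rewrite ffunE Aj !mul0r.
Qed.

Lemma coef_mul_gen j a C :
  (a * gen j) C = clsign (symdiff [set j] C) [set j] * a (symdiff [set j] C).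
Proof.
rewrite -clmulE clmul_coef (bigD1 (symdiff [set j] C)) //= big1 => [|A Aj].
  by rewrite -symdiffA symdiffss symdiffs0 ffunE eqxx addr0 mulr1 mulrC.
by rewrite ffunE symdiffC symdiff_eq symdiffC (negPf Aj) mulr0 mul0r.
Qed.

Lemma gen_anticomm i j : gen i * gen j + gen j * gen i = (- (2 * (i == j)%:R))%:A :> clifford F m.
Proof.
apply/ffunP=> C; rewrite ffunE coef_gen_mul coef_mul_gen !ffunE clsign1C.
rewrite -[C](symdiffK [set i]) symdiffK; set D := symdiff [set i] C.
have [->|Dj] := eqVneq D [set j]; last first.
  rewrite symdiff_eq symdiffs0; have [ij|_] := eqVneq i j; last by rewrite !mulr0 oppr0 mul0r addr0.
  by rewrite -ij in Dj; rewrite (negPf Dj) !mulr0 addr0.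
rewrite cards1 inE symdiff_eq symdiffs0 (inj_eq set1_inj) eq_sym.
case: eqP => [->|_] /=; last by ring.
by rewrite clsign11; ring.
Qed.

Lemma vector_anticomm x y :
  vector x * vector y + vector y * vector x
  = (- (2 * \sum_j x j * y j))%:A.
Proof.
have mul_vector (z w : 'I_m -> F) :
    vector z * vector w = \sum_i \sum_j (z i * w j) *: (gen i * gen j).
  rewrite !vectorE mulr_suml; apply: eq_bigr => i _; rewrite mulr_sumr.
  by apply: eq_bigr => j _; rewrite -scalerAl -scalerAr scalerA.
rewrite !mul_vector [X in _ + X]exchange_big -big_split /= mulr_sumr -sumrN scaler_suml.
apply: eq_bigr => i _; rewrite -big_split (bigD1 i) //= big1 => [|j /negPf ji].
  by rewrite addr0 [y i * _]mulrC -scalerDr gen_anticomm eqxx scalerA mulr1 mulrC mulNr.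
by rewrite [y j * _]mulrC -scalerDr gen_anticomm eq_sym ji scalerA mulr0 oppr0 mulr0 scale0r.
Qed.

Lemma vector_delta j : vector (fun i => (i == j)%:R) = gen j :> clifford F m.
Proof.
by rewrite vectorE (bigD1 j) //= eqxx scale1r big1 ?addr0 // => i /negPf->; rewrite scale0r.
Qed.

Lemma coords_vector x : coords (vector x) = x.
Proof.
apply/funext=> i; rewrite /coords /vector /xvec sum_ffunE (bigD1 i) //= big1 => [|j ji].
  by rewrite !ffunE eqxx mulr1 addr0.
by rewrite !ffunE (inj_eq set1_inj) [i == j]eq_sym (negPf ji) mulr0.
Qed.

Lemma vector_sqr x : vector x * vector x = (- \sum_j x j ^+ 2)%:A.
Proof.
have two_neq0 : 2 != 0 :> F by rewrite pnatr_eq0.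
apply: (scalerI two_neq0); rewrite scaler_nat mulr2n vector_anticomm scalerA mulrN.
by under [in RHS]eq_bigr do rewrite expr2.
Qed.

Lemma gen_sqr j : gen j * gen j = -1 :> clifford F m.
Proof.
rewrite -vector_delta vector_sqr (bigD1 j) //= eqxx expr1n big1 ?addr0 ?scaleN1r //.
by move=> i /negPf->; rewrite expr0n.
Qed.

Lemma gen_mulK j a : gen j * (gen j * a) = - a.
Proof. by rewrite mulrA gen_sqr mulN1r. Qed.

Lemma gen_mulC i j : i != j -> gen i * gen j = - (gen j * gen i) :> clifford F m.
Proof.
by move=> /negPf ij; apply/eqP; rewrite -addr_eq0 gen_anticomm ij mulr0 oppr0 scale0r.
Qed.

Lemma gen_mulCA i j a : i != j -> gen i * (gen j * a) = - (gen j * (gen i * a)).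
Proof. by move=> ij; rewrite !mulrA gen_mulC // mulNr. Qed.

End Generators.

(** * Exterior and interior multiplication *)

Section HalfProducts.
Variables (F : numFieldType) (m : nat).
Implicit Types (A C : {set 'I_m}) (a : clifford F m) (i j : 'I_m) (b : bool).

(* The exterior ([b = true]) or interior ([b = false]) part of the product [e_j a]. *)
Definition half_mul b j a : clifford F m :=
  [ffun C : {set 'I_m} => if (j \in C) == b then (gen j * a) C else 0].

Fact half_mul_linear b j : linear (half_mul b j).
Proof.
move=> x a a'; apply/ffunP=> C; rewrite !ffunE mulrDr -scalerAr !ffunE.
by case: ifP; rewrite // mulr0 addr0.
Qed.

HB.instance Definition _ b j := GRing.isLinear.Build F (clifford F m) (clifford F m)
  *:%R (half_mul b j) (half_mul_linear b j).

Lemma half_mulD j a : half_mul true j a + half_mul false j a = gen j * a.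
Proof. by apply/ffunP=> C; rewrite !ffunE; case: (j \in C); rewrite ?addr0 ?add0r. Qed.

Lemma half_mul_half_mul b i j a :
  half_mul b i (half_mul b j a) = [ffun C : {set 'I_m} =>
    if [&& i != j, (i \in C) == b & (j \in C) == b] then (gen i * (gen j * a)) C else 0].
Proof.
apply/ffunP=> C; rewrite !ffunE coef_gen_mul ffunE in_symdiff inE [j == i]eq_sym.
rewrite [in RHS]coef_gen_mul.
have [<-|_] /= := eqVneq i j; last by do 2!case: (_ == b); rewrite ?mulr0.
by case: (i \in C); case: b => //=; rewrite mulr0.
Qed.

Lemma half_mul_anticomm b i j a : half_mul b i (half_mul b j a) = - half_mul b j (half_mul b i a).
Proof.
rewrite !half_mul_half_mul [j == i]eq_sym; apply/ffunP=> C; rewrite !ffunE.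
rewrite [((j \in C) == b) && _]andbC; have [_|ij] := eqVneq i j; first by rewrite oppr0.
by case: (_ && _); rewrite ?oppr0 // gen_mulCA // ffunE.
Qed.

Lemma graded_commutatorE (x : F) j a C :
  (\sum_(s < m.+1) clscale (2%:R^-1)
     (clmul (vec j) (gproj s a) + clscale (x * (-1) ^+ s) (clmul (gproj s a) (vec j)))) C
  = 2%:R^-1 * (1 + x * (-1) ^+ (j \notin C)) * (gen j * a) C.
Proof.
have card_lt : (#|symdiff [set j] C| < m.+1)%N.
  by rewrite ltnS -[X in (_ <= X)%N]card_ord max_card.
under eq_bigr do rewrite !clmulE !clscaleE.
rewrite sum_ffunE (bigD1 (Ordinal card_lt)) //= big1 => [|s].
  rewrite !ffunE !coef_gen_mul coef_mul_gen !ffunE eqxx addr0 clsign1C.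
  rewrite in_symdiff inE eqxx addTb exprD.
  have sign_sqr : (-1) ^+ #|symdiff [set j] C| * (-1) ^+ #|symdiff [set j] C| = 1 :> F.
    by rewrite -expr2 sqrr_sign.
  by ring: sign_sqr.
rewrite -val_eqE /= eq_sym => /negPf sC.
by rewrite !ffunE coef_gen_mul coef_mul_gen !ffunE sC !mulr0 addr0 mulr0.
Qed.

Lemma wedgev_vec j : wedgev (vec j) = half_mul true j.
Proof.
apply/funext=> a; apply/ffunP=> C; rewrite /wedgev.
under eq_bigr => s _ do rewrite -[(-1) ^+ s]mul1r.
rewrite graded_commutatorE ffunE; case: (j \in C) => /=; last by rewrite mul1r addrN mulr0 mul0r.
by rewrite mulr1 -mulr2n mulVf ?mul1r // pnatr_eq0.
Qed.

Lemma dotv_vec j : dotv (vec j) = half_mul false j.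
Proof.
apply/funext=> a; apply/ffunP=> C; rewrite /dotv.
under eq_bigr => s _ do rewrite clscaleE -(@scaleN1r _ (clifford F m)) scalerA.
rewrite graded_commutatorE ffunE; case: (j \in C) => /=; first by rewrite mulr1 addrN mulr0 mul0r.
by rewrite mulrNN mulr1 -mulr2n mulVf ?mul1r // pnatr_eq0.
Qed.

End HalfProducts.

Section BladeSpan.
Variables (F : numFieldType) (m : nat).
Implicit Types (A C : {set 'I_m}) (S : {set {set 'I_m}}) (a : clifford F m).

Definition blade_span S : {pred clifford F m} := fun a => [forall A, (A \notin S) ==> (a A == 0)].

Lemma blade_spanP S a : reflect (forall A, A \notin S -> a A = 0) (a \in blade_span S).
Proof.
apply: (iffP forallP) => [aS A AS|aS A]; first by move/implyP: (aS A) => /(_ AS)/eqP.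
by apply/implyP=> /aS->.
Qed.

Fact blade_span_submod_closed S : submod_closed (blade_span S).
Proof.
split=> [|x a b /blade_spanP aS /blade_spanP bS]; apply/blade_spanP=> A AS.
  by rewrite ffunE.
by rewrite !ffunE aS // bS // mulr0 addr0.
Qed.

HB.instance Definition _ S := GRing.isSubmodClosed.Build F (clifford F m) (blade_span S)
  (blade_span_submod_closed S).

Lemma blade_spanI S S' a :
  (a \in blade_span (S :&: S')) = (a \in blade_span S) && (a \in blade_span S').
Proof.
apply/blade_spanP/andP=> [aSS'|[/blade_spanP aS /blade_spanP aS'] A].
  by split; apply/blade_spanP=> A /negPf AS; rewrite aSS' // inE AS ?andbF.
by rewrite inE negb_and => /orP[/aS|/aS'].
Qed.

Lemma blade_span_disjoint S S' a :
  [disjoint S & S'] -> a \in blade_span S -> a \in blade_span S' -> a = 0.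
Proof.
move=> SS' /blade_spanP aS /blade_spanP aS'; apply/ffunP=> A; rewrite ffunE.
by have [AS|/aS//] := boolP (A \in S); rewrite aS' // (disjointFr SS').
Qed.

Lemma half_mul_blade_span (b : bool) (j : 'I_m) S S' a :
    (forall A, A \in S -> (j \in A) != b -> symdiff [set j] A \in S') ->
  a \in blade_span S -> half_mul b j a \in blade_span S'.
Proof.
move=> SS' /blade_spanP aS; apply/blade_spanP=> C CS'; rewrite ffunE coef_gen_mul.
case: ifP => // /eqP jC; rewrite aS ?mulr0 //; apply: contraNN CS' => /SS'.
by rewrite symdiffK in_symdiff inE eqxx jC; apply; case: b {jC SS'}.
Qed.

Definition grade (t : int) : {set {set 'I_m}} := [set A : {set 'I_m} | #|A|%:Z == t].

Lemma is_gradeP t a : is_grade t a <-> a \in blade_span (grade t).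
Proof.
split=> [agrade|/blade_spanP aS A aA].
  by apply/blade_spanP=> A; rewrite inE; apply: contraNeq => /agrade ->.
by apply/eqP; apply: contraNT aA => At; rewrite aS // inE.
Qed.

Lemma grade_disjoint t t' a : t != t' ->
  a \in blade_span (grade t) -> a \in blade_span (grade t') -> a = 0.
Proof.
move=> tt'; apply: blade_span_disjoint; apply/pred0P=> A /=.
by rewrite !inE; apply: contraNF tt' => /andP[/eqP<- /eqP<-].
Qed.

End BladeSpan.

Arguments grade {m} t.

(** * First-order operators *)

Definition incr {m : nat} (j : 'I_m) (al : mi m) : mi m := [ffun i => (al i + (i == j))%N].

Definition decr {m : nat} (j : 'I_m) (al : mi m) : mi m := [ffun i => (al i - (i == j))%N].

Definition mdeg {m : nat} (al : mi m) : nat := \sum_i al i.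

Section MultiIndices.
Variable m : nat.
Implicit Types (al : mi m) (i j : 'I_m).

Lemma incrE j al i : incr j al i = (al i + (i == j))%N.
Proof. by rewrite ffunE. Qed.

Lemma incrC i j al : incr i (incr j al) = incr j (incr i al).
Proof. by apply/ffunP=> l; rewrite !ffunE addnAC. Qed.

Lemma incrK j : cancel (incr j) (decr j).
Proof. by move=> al; apply/ffunP=> i; rewrite !ffunE addnK. Qed.

Lemma mdeg_incr j al : mdeg (incr j al) = (mdeg al).+1.
Proof.
rewrite /mdeg -addn1; under eq_bigr do rewrite incrE.
rewrite big_split /=; congr (_ + _)%N.
by rewrite (bigD1 j) //= eqxx big1 // => i /negPf->.
Qed.

End MultiIndices.

Lemma eq_oppr_eq0 (K : numFieldType) (V : lmodType K) (a : V) : a = - a -> a = 0.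
Proof.
by move/eqP; rewrite -addr_eq0 -mulr2n -scaler_nat scaler_eq0 pnatr_eq0 => /eqP.
Qed.

Section Gradients.
Variables (F : numFieldType) (m : nat).
Local Notation clpoly := (mi m -> clifford F m).
Implicit Types (P Q : clpoly) (al : mi m) (i j : 'I_m) (S : {set {set 'I_m}}).

Lemma pderivE j P al : pderiv j P al = (al j).+1%:R *: P (incr j al).
Proof. by []. Qed.

Lemma pderiv_linear j : linear (pderiv j : clpoly -> clpoly).
Proof.
by move=> x P Q; apply/funext=> al; rewrite !(fctE, pderivE) scalerDr !scalerA [_ * x]mulrC.
Qed.

Lemma pderivC i j P : pderiv i (pderiv j P) = pderiv j (pderiv i P).
Proof.
apply/funext=> al; rewrite !pderivE !scalerA incrC !incrE [j == i]eq_sym.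
by have [->|_] := eqVneq i j; rewrite // !addn0 mulrC.
Qed.

Lemma pderiv_comp j (T : {linear clifford F m -> clifford F m}) P :
  pderiv j (T \o P) = T \o pderiv j P.
Proof. by apply/funext=> al; rewrite /= !pderivE linearZZ. Qed.

Definition low_gradient (T : 'I_m -> {linear clifford F m -> clifford F m}) P : clpoly :=
  fun al => \sum_(j : 'I_m | low j) T j (pderiv j P al).

Section LowGradient.
Variable T : 'I_m -> {linear clifford F m -> clifford F m}.

Fact low_gradient_linear : linear (low_gradient T).
Proof.
move=> x P Q; apply/funext=> al; rewrite ![in RHS]fctE /low_gradient scaler_sumr -big_split.
by apply: eq_bigr => j _ /=; rewrite pderiv_linear fctE linearP.
Qed.

Lemma low_gradient_neq0 P al : low_gradient T P al != 0 -> exists2 j, low j & P (incr j al) != 0.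
Proof.
move=> TPal; apply: contrapT => nP; case/eqP: TPal; rewrite /low_gradient big1 // => j jl.
rewrite pderivE; have [->|Pj] := eqVneq (P (incr j al)) 0; first by rewrite scaler0 linear0.
by case: nP; exists j.
Qed.

Lemma low_gradient_blade_span S S' P al :
    (forall j a, low j -> a \in blade_span S -> T j a \in blade_span S') ->
  (forall be, P be \in blade_span S) -> low_gradient T P al \in blade_span S'.
Proof. by move=> TS PS; apply: rpred_sum => j jl; apply: TS => //; apply: rpredZ. Qed.

Lemma low_gradient_sqr0 P :
    (forall i j a, T i (T j a) = - T j (T i a)) -> low_gradient T (low_gradient T P) = 0.
Proof.
move=> Tanti; apply/funext=> al.
have double_sumE : low_gradient T (low_gradient T P) al =
    \sum_(j : 'I_m | low j) \sum_(i : 'I_m | low i) T j (T i (pderiv i (pderiv j P) al)).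
  apply: eq_bigr => j _; rewrite pderivE /low_gradient scaler_sumr linear_sum.
  by apply: eq_bigr => i _; rewrite pderivC [in RHS]pderivE [in RHS]linearZZ.
apply: eq_oppr_eq0; rewrite {1}double_sumE exchange_big double_sumE -sumrN; apply: eq_bigr => j _.
by rewrite -sumrN; apply: eq_bigr => i _; rewrite Tanti pderivC.
Qed.

End LowGradient.

HB.instance Definition _ T :=
  GRing.isLinear.Build F clpoly clpoly *:%R (low_gradient T) (low_gradient_linear T).

Lemma dplusE : dplus = low_gradient (half_mul true).
Proof. by apply/funext=> P; apply/funext=> al; apply: eq_bigr => j _; rewrite wedgev_vec. Qed.

Lemma dminusE : dminus = low_gradient (half_mul false).
Proof. by apply/funext=> P; apply/funext=> al; apply: eq_bigr => j _; rewrite dotv_vec. Qed.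

Lemma dunderE : dunder = low_gradient (fun j => gen j \*o idfun).
Proof. by []. Qed.

Lemma dplusZ x P : dplus (pscale x P) = pscale x (dplus P).
Proof. by rewrite dplusE; exact: (linearZZ (low_gradient _)). Qed.

Lemma dminusZ x P : dminus (pscale x P) = pscale x (dminus P).
Proof. by rewrite dminusE; exact: (linearZZ (low_gradient _)). Qed.

Lemma dplus_dplus P : dplus (dplus P) = 0.
Proof. by rewrite dplusE low_gradient_sqr0 // => i j a; exact: half_mul_anticomm. Qed.

Lemma dminus_dminus P : dminus (dminus P) = 0.
Proof. by rewrite dminusE low_gradient_sqr0 // => i j a; exact: half_mul_anticomm. Qed.

Lemma dunder_split P : dunder P = padd (dplus P) (dminus P).
Proof.
apply/funext=> al; rewrite dplusE dminusE /padd /low_gradient -big_split.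
by apply: eq_bigr => j _; rewrite -[LHS]half_mulD.
Qed.

Lemma prmulE P a al : prmul P a al = P al * a. Proof. by []. Qed.

Lemma dunder_prmul P a : dunder (prmul P a) = prmul (dunder P) a.
Proof.
apply/funext=> al; rewrite prmulE mulr_suml; apply: eq_bigr => j _.
by rewrite !clmulE !pderivE prmulE scalerAl mulrA.
Qed.

Lemma pscale0 (x : F) : pscale x 0 = 0 :> clpoly.
Proof. by apply/funext=> al; exact: scaler0. Qed.

Lemma prmulZ x P a : prmul (pscale x P) a = pscale x (prmul P a).
Proof. by apply/funext=> al; rewrite prmulE /pscale !clscaleE scalerAl. Qed.

End Gradients.

(** * The last variable *)

Section LastVariable.
Variables (F : numFieldType) (n : nat).
Local Notation m := n.+1.
Local Notation last := (@ord_max n).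
Local Notation clpoly := (mi m -> clifford F m).
Implicit Types (P Q u v : clpoly) (a b : clifford F m) (al : mi m) (A C : {set 'I_m}).
Implicit Types (i j : 'I_m) (t : int).

Lemma eq_last i : (val i == m.-1) = (i == last).
Proof. by rewrite -val_eqE. Qed.

Lemma lowE i : low i = (i != last).
Proof. by rewrite /low ltn_neqAle -ltnS ltn_ord andbT eq_last. Qed.

Lemma emE : em = gen last :> clifford F m.
Proof. by congr blade; apply/setP=> i; rewrite !inE eq_last. Qed.

Lemma alastE al : alast al = al last.
Proof. by rewrite /alast (big_pred1 last) // => i; rewrite eq_last. Qed.

Lemma incr_low j al : low j -> incr j al last = al last.
Proof. by rewrite lowE incrE eq_sym => /negPf->; rewrite addn0. Qed.

Lemma incr_last al : incr last al last = (al last).+1.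
Proof. by rewrite incrE eqxx addn1. Qed.

Lemma lowvarP P : lowvar P <-> forall al, al last != 0%N -> P al = 0.
Proof.
split=> [Pl al|Pl al i /eqP]; first exact: (Pl al last).
by rewrite eq_last => /eqP->; exact: Pl.
Qed.

Lemma lowvar_low_gradient T P : lowvar P -> lowvar (low_gradient T P).
Proof.
move=> /lowvarP Pl; apply/lowvarP=> al al0; apply: contraNeq al0 => /low_gradient_neq0[j jl].
by rewrite -(incr_low al jl); apply: contraNT => /Pl->.
Qed.

Definition low_blades : {set {set 'I_m}} := [set A : {set 'I_m} | last \notin A].

Lemma lowalgP P : lowalg P <-> forall al, P al \in blade_span low_blades.
Proof.
split=> [Pl al|Pl al A i iA /eqP].
  by apply/blade_spanP=> A; rewrite inE negbK => lA; exact: (Pl al A last).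
rewrite eq_last => /eqP il; apply: (blade_spanP _ _ (Pl al)).
by rewrite inE negbK -il.
Qed.

Definition low_multivector t P :=
  lowvar P /\ forall al, P al \in blade_span (low_blades :&: grade t).

Lemma low_multivector_low t P al : low_multivector t P -> P al \in blade_span low_blades.
Proof. by move=> [_ /(_ al)]; rewrite blade_spanI => /andP[]. Qed.

Lemma low_multivector_grade t P al : low_multivector t P -> P al \in blade_span (grade t).
Proof. by move=> [_ /(_ al)]; rewrite blade_spanI => /andP[]. Qed.

Lemma low_multivectorZ t (x : F) P : low_multivector t P -> low_multivector t (pscale x P).
Proof.
move=> [/lowvarP Pl Pt]; split=> [|al]; last exact: rpredZ.
by apply/lowvarP=> al /Pl; rewrite /pscale clscaleE => ->; rewrite scaler0.
Qed.

Lemma low_multivector_half_gradient (b : bool) t P : low_multivector t P ->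
  low_multivector (if b then t + 1 else t - 1) (low_gradient (half_mul b) P).
Proof.
move=> [Pl Pt]; split=> [|al]; first exact: lowvar_low_gradient.
apply: low_gradient_blade_span Pt => j a; rewrite lowE => jl.
apply: half_mul_blade_span => A; rewrite !inE => /andP[lA /eqP <-] jA.
rewrite [last == j]eq_sym (negPf jl) (negPf lA) /=.
rewrite -/(symdiff _ _) card_symdiff1.
case: b jA; case: ifP => // jA _; first by rewrite -addn1 PoszD.
by rewrite [#|A|](cardsD1 j) jA PoszD addrC addKr.
Qed.

Lemma low_multivector_dplus t P : low_multivector t P -> low_multivector (t + 1) (dplus P).
Proof. by rewrite dplusE; exact: (low_multivector_half_gradient true). Qed.

Lemma low_multivector_dminus t P : low_multivector t P -> low_multivector (t - 1) (dminus P).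
Proof. by rewrite dminusE; exact: (low_multivector_half_gradient false). Qed.

Lemma dplus_eq0 t u : low_multivector t u ->
  (forall al, dunder u al \in blade_span (grade (t - 1))) -> dplus u = 0.
Proof.
move=> ut du; apply/funext=> al; apply: (@grade_disjoint _ _ (t + 1) (t - 1)); first lia.
  exact: low_multivector_grade (low_multivector_dplus ut).
have dm := low_multivector_grade al (low_multivector_dminus ut).
by rewrite -(rpredDr _ dm); have := du al; rewrite dunder_split.
Qed.

Lemma dminus_eq0 t v : low_multivector t v ->
  (forall al, dunder v al \in blade_span (grade (t + 1))) -> dminus v = 0.
Proof.
move=> vt dv; apply/funext=> al; apply: (@grade_disjoint _ _ (t - 1) (t + 1)); first lia.
  exact: low_multivector_grade (low_multivector_dminus vt).
have dp := low_multivector_grade al (low_multivector_dplus vt).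
by rewrite -(rpredDl _ dp); have := dv al; rewrite dunder_split.
Qed.

Lemma dunder_low t P al : low_multivector t P -> dunder P al \in blade_span low_blades.
Proof.
move=> Pt; rewrite dunder_split; apply: rpredD.
  exact: low_multivector_low (low_multivector_dplus Pt).
exact: low_multivector_low (low_multivector_dminus Pt).
Qed.

Lemma gen_last_mulC t a : a \in blade_span (low_blades :&: grade t) ->
  gen last * a = (-1) ^ t *: (a * gen last).
Proof.
move=> /blade_spanP agrade; apply/ffunP=> C; rewrite ffunE coef_gen_mul coef_mul_gen clsign1C.
set D := symdiff _ _; have [|/agrade->] := boolP (D \in low_blades :&: grade t); last first.
  by rewrite !mulr0.
rewrite !inE => /andP[/negPf-> /eqP<-].
by rewrite addn0 !mulrA -exprnP -expr2 sqrr_sign mul1r.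
Qed.

Lemma coef_mul_gen_last b C : b \in blade_span low_blades ->
  (b * gen last) C = if last \in C then b (symdiff [set last] C) else 0.
Proof.
move=> /blade_spanP bl; rewrite coef_mul_gen clsign1r.
case: ifPn => lC; last by rewrite bl ?mulr0 // inE negbK in_symdiff inE eqxx.
rewrite big1 ?mul1r // => i iC; rewrite leqNgt.
have : low i by rewrite lowE; apply: contraTneq iC => ->; rewrite in_symdiff inE eqxx lC.
by rewrite /low => ->.
Qed.

Lemma gradeD_mul_gen_last t a b :
    a \in blade_span low_blades -> b \in blade_span low_blades ->
  (a + b * gen last \in blade_span (grade t)) =
  (a \in blade_span (grade t)) && (b \in blade_span (grade (t - 1))).
Proof.
move=> alow blow.
have abE C : (a + b * gen last) C = if last \in C then b (symdiff [set last] C) else a C.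
  rewrite ffunE coef_mul_gen_last //; case: ifPn => lC; last by rewrite addr0.
  by rewrite (blade_spanP _ _ alow) ?add0r // inE negbK.
have gradeS C : last \notin C -> (symdiff [set last] C \in grade t) = (C \in grade (t - 1)).
  by move=> lC; rewrite !inE -/(symdiff _ _) card_symdiff1 (negPf lC) eq_sym -subr_eq; lia.
apply/idP/andP=> [/blade_spanP abgrade|[/blade_spanP agrade /blade_spanP bgrade]].
  split; apply/blade_spanP=> C Ct; have [lC|lC] := boolP (last \in C).
  - by rewrite (blade_spanP _ _ alow) // inE negbK.
  - by have := abgrade C Ct; rewrite abE (negPf lC).
  - by rewrite (blade_spanP _ _ blow) // inE negbK.
  - have := abgrade (symdiff [set last] C); rewrite gradeS // => /(_ Ct).
    by rewrite abE in_symdiff inE eqxx (negPf lC) symdiffK.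
apply/blade_spanP=> C Ct; rewrite abE; case: ifPn => lC; last exact: agrade.
by apply: bgrade; rewrite -gradeS ?symdiffK // in_symdiff inE eqxx lC.
Qed.

Definition low_part a : clifford F m := [ffun A : {set 'I_m} => if last \in A then 0 else a A].

Definition top_part a : clifford F m :=
  [ffun A : {set 'I_m} => if last \in A then 0 else a (symdiff [set last] A)].

Lemma low_part_low a : low_part a \in blade_span low_blades.
Proof. by apply/blade_spanP=> A; rewrite inE negbK ffunE => ->. Qed.

Lemma top_part_low a : top_part a \in blade_span low_blades.
Proof. by apply/blade_spanP=> A; rewrite inE negbK ffunE => ->. Qed.

Lemma low_top_split a : a = low_part a + top_part a * gen last.
Proof.
apply/ffunP=> C; rewrite [RHS]ffunE coef_mul_gen_last ?top_part_low // !ffunE.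
by rewrite in_symdiff inE eqxx symdiffK; case: ifP; rewrite ?addr0 ?add0r.
Qed.

Lemma low_part0 : low_part 0 = 0.
Proof. by apply/ffunP=> C; rewrite !ffunE if_same. Qed.

Lemma top_part0 : top_part 0 = 0.
Proof. by apply/ffunP=> C; rewrite !ffunE if_same. Qed.

Lemma homog_comp (f : clifford F m -> clifford F m) k P : f 0 = 0 -> homog k P -> homog k (f \o P).
Proof. by move=> f0 Pk al fP; apply: Pk; apply: contraNN fP => /eqP/= ->; rewrite f0. Qed.

Lemma lowvar_comp (f : clifford F m -> clifford F m) P : f 0 = 0 -> lowvar P -> lowvar (f \o P).
Proof. by move=> f0 /lowvarP Pl; apply/lowvarP => al /Pl/= ->. Qed.

Definition emd P : clpoly := fun al => gen last * dunder P al.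

Lemma emd_gradientE : emd = low_gradient (fun j => (gen last * gen j) \*o idfun).
Proof.
apply/funext=> P; apply/funext=> al; rewrite /emd dunderE /low_gradient mulr_sumr.
by apply: eq_bigr => j _ /=; rewrite mulrA.
Qed.

Fact emd_linear : linear emd.
Proof. by rewrite emd_gradientE; exact: low_gradient_linear. Qed.

HB.instance Definition _ := GRing.isLinear.Build F clpoly clpoly *:%R emd emd_linear.

Lemma signz_subr1 t : (-1) ^ (t - 1) = (-1) ^ (t + 1) :> F.
Proof. by rewrite !exprzDr ?unitrN1 // expr1z exprN1 invrN1. Qed.

Lemma emd_low t P : low_multivector t P ->
  emd P = pscale ((-1) ^ (t + 1)) (prmul (dunder P) em).
Proof.
move=> Pt; apply/funext=> al; rewrite /emd dunder_split emE.
have [_ /(_ al)/gen_last_mulC plus_mulC] := low_multivector_dplus Pt.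
have [_ /(_ al)/gen_last_mulC minus_mulC] := low_multivector_dminus Pt.
by rewrite mulrDr plus_mulC minus_mulC signz_subr1 -scalerDr -mulrDl.
Qed.

Lemma emd_low_mul_em t P : low_multivector t P ->
  emd (prmul P em) = pscale ((-1) ^ t) (dunder P).
Proof.
move=> Pt; apply/funext=> al; rewrite /emd emE dunder_prmul prmulE mulrA.
have := congr1 (fun Q => Q al) (emd_low Pt); rewrite /emd emE => ->.
rewrite /pscale clscaleE -scalerAl prmulE -mulrA gen_sqr mulrN1 scalerN -scaleNr.
by rewrite exprzDr ?unitrN1 // expr1z mulrN1 opprK.
Qed.

End LastVariable.

Arguments emd {F n} P.
Arguments low_part {F n} a.
Arguments top_part {F n} a.
Arguments low_part0 {F n}.
Arguments top_part0 {F n}.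
Arguments low_blades {n}.

(** * The Cauchy-Kovalevskaya extension *)

Lemma eq_sum_ord_support (V : nmodType) (f : nat -> V) a b :
    (forall l, (a <= l)%N -> f l = 0) -> (forall l, (b <= l)%N -> f l = 0) ->
  \sum_(l < a) f l = \sum_(l < b) f l.
Proof.
wlog ab : a b / (a <= b)%N => [wlog_ab fa fb|fa _].
  by case/orP: (leq_total a b) => ab; [|symmetry]; apply: wlog_ab.
rewrite (big_ord_widen b) // big_mkcond; apply: eq_bigr => l _.
by case: ltnP => // /fa->.
Qed.

Section CauchyKovalevskaya.
Variables (F : numFieldType) (n : nat).
Local Notation m := n.+1.
Local Notation last := (@ord_max n).
Local Notation clpoly := (mi m -> clifford F m).
Implicit Types (P Q : clpoly) (al be : mi m) (i j : 'I_m) (d k : nat).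

Lemma emd_iterE d P : emd_iter d P = iter d emd P.
Proof. by rewrite /emd_iter; apply: eq_iter => Q; rewrite emE. Qed.

Lemma shiftm_last d al : shiftm d al last = (al last - d)%N.
Proof. by rewrite ffunE eqxx. Qed.

Lemma shiftm_low d j al : low j -> shiftm d al j = al j.
Proof. by rewrite lowE ffunE eq_last => /negPf->. Qed.

Lemma shiftm_incr_low d j al : low j -> shiftm d (incr j al) = incr j (shiftm d al).
Proof.
rewrite lowE => jl; apply/ffunP=> i; rewrite !ffunE eq_last.
by case: eqP => // ->; rewrite eq_sym (negPf jl) !addn0.
Qed.

Lemma shiftm_incr_last d al : shiftm d.+1 (incr last al) = shiftm d al.
Proof. by apply/ffunP=> i; rewrite !ffunE eq_last; case: eqP; rewrite ?addn1 ?addn0. Qed.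

Lemma shiftm0 al : shiftm 0 al = al.
Proof. by apply/ffunP=> i; rewrite !ffunE subn0 if_same. Qed.

Lemma mdeg_shiftm d al : (d <= al last)%N -> (mdeg (shiftm d al) + d = mdeg al)%N.
Proof.
move=> dl; rewrite /mdeg (bigD1 last) //= [RHS](bigD1 last) //= shiftm_last.
rewrite addnAC subnK //; congr (_ + _)%N.
by apply: eq_bigr => i il; rewrite shiftm_low // lowE.
Qed.

Lemma emd_neq0 P al : emd P al != 0 -> exists2 j, low j & P (incr j al) != 0.
Proof. by rewrite emd_gradientE; exact: low_gradient_neq0. Qed.

Lemma lowvar_iter_emd d P : lowvar P -> lowvar (iter d emd P).
Proof.
by move=> Pl; elim: d => // d; rewrite iterS {2}emd_gradientE; exact: lowvar_low_gradient.
Qed.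

Lemma mdeg_iter_emd k d P al :
  homog k P -> iter d emd P al != 0 -> (mdeg al + d)%N = k.
Proof.
move=> Pk; elim: d al => [|d IHd] al; first by rewrite addn0; exact: Pk.
by rewrite iterS => /emd_neq0[j _ /IHd]; rewrite mdeg_incr addSnnS.
Qed.

Lemma eq_emd_shiftm d P Q al :
    (forall j, low j -> P (incr j al) = Q (shiftm d (incr j al))) ->
  emd P al = emd Q (shiftm d al).
Proof.
move=> PQ; rewrite /emd; congr (_ * _); apply: eq_bigr => j jl.
by rewrite !clmulE !pderivE shiftm_low // -shiftm_incr_low // PQ.
Qed.

(* The monomial [x_m ^ d / d!] times [P]. *)
Definition taylor_term d P : clpoly :=
  fun al => if (d <= al last)%N then (d`!%:R)^-1 *: P (shiftm d al) else 0.

Fact taylor_term_linear d : linear (taylor_term d).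
Proof.
move=> x P Q; apply/funext=> al; rewrite ![in RHS]fctE /taylor_term.
case: ifP => _; last by rewrite scaler0 addr0.
by rewrite fctE scalerDr !scalerA mulrC.
Qed.

HB.instance Definition _ d :=
  GRing.isLinear.Build F clpoly clpoly *:%R (taylor_term d) (taylor_term_linear d).

Lemma taylor_term_mulxm d P al :
  taylor_term d P al = clscale (d`!%:R)^-1 (mulxm d P al).
Proof. by rewrite /taylor_term /mulxm alastE; case: ifP => // _; rewrite clscaleE scaler0. Qed.

Lemma taylor_term_homog k d P :
  (forall al, P al != 0 -> (mdeg al + d)%N = k) -> homog k (taylor_term d P).
Proof.
move=> Pk al; rewrite /taylor_term; case: ifP; last by rewrite eqxx.
move=> dl nz; rewrite [LHS](esym (mdeg_shiftm dl)); apply: Pk.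
by apply: contraNN nz => /eqP->; rewrite scaler0.
Qed.

Lemma CKE P al : CK P al = \sum_(d < (al last).+1) taylor_term d (iter d emd P) al.
Proof. by rewrite /CK alastE; apply: eq_bigr => d _; rewrite taylor_term_mulxm emd_iterE. Qed.

Lemma CK_linear_combination x y P Q :
  CK (padd (pscale x P) (pscale y Q)) = padd (pscale x (CK P)) (pscale y (CK Q)).
Proof.
apply/funext=> al; rewrite /padd /pscale !clscaleE !CKE !scaler_sumr -big_split.
apply: eq_bigr => d _ /=.
have iter_lin e : iter e emd (x *: P + y *: Q) = x *: iter e emd P + y *: iter e emd Q.
  by elim: e => // e IHe; rewrite !iterS IHe emd_linear (linearZZ emd).
rewrite -[iter d emd _]/(iter d emd (x *: P + y *: Q)) iter_lin.
by rewrite taylor_term_linear (linearZZ (taylor_term d)).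
Qed.

Lemma CK_homogE k P : homog k P ->
  CK P = \sum_(d < k.+1) taylor_term d (iter d emd P).
Proof.
move=> Pk; apply/funext=> al; rewrite CKE fct_sumE.
apply: (eq_sum_ord_support (f := fun d => taylor_term d (iter d emd P) al)) => d.
  by rewrite ltnNge /taylor_term => /negPf->.
move=> kd; rewrite /taylor_term; case: ifP => // _.
have [->|/(mdeg_iter_emd Pk) degP] := eqVneq (iter d emd P (shiftm d al)) 0.
  by rewrite scaler0.
by move: kd; rewrite -degP ltnNge leq_addl.
Qed.

Lemma CK_homog k P : homog k P -> homog k (CK P).
Proof.
move=> Pk al; apply: contraNeq => alk; rewrite CKE big1 // => d _.
by apply: contraNeq alk => /(taylor_term_homog (fun be => mdeg_iter_emd Pk))->.
Qed.

Lemma CK_lowvarE P al : lowvar P ->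
  CK P al = ((al last)`!%:R)^-1 *: iter (al last) emd P (shiftm (al last) al).
Proof.
move=> Pl; rewrite CKE big_ord_recr /= big1 ?add0r => [|d _]; rewrite /taylor_term.
  by rewrite leqnn.
have /lowvarP PE := lowvar_iter_emd d Pl.
by rewrite ltnW // PE ?scaler0 // shiftm_last subn_eq0 -ltnNge.
Qed.

Definition monogenic P : Prop := forall al, dirac P al = 0.

Lemma diracE P al : dirac P al = dunder P al + gen last * pderiv last P al.
Proof.
rewrite /dirac (bigD1 last) //= addrC; congr (_ + _).
by apply: eq_bigl => j; rewrite lowE.
Qed.

Lemma monogenicP P :
  monogenic P <-> (forall al, (al last).+1%:R *: P (incr last al) = emd P al).
Proof.
have diracP al : gen last * dirac P al = emd P al - (al last).+1%:R *: P (incr last al).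
  by rewrite diracE mulrDr gen_mulK.
split=> [P0 al|PE al]; apply/eqP.
  by rewrite eq_sym -subr_eq0 -diracP P0 mulr0.
by rewrite -oppr_eq0 -(gen_mulK last) diracP PE subrr mulr0.
Qed.

Lemma factS_inv d : (d.+1)%:R * ((d.+1)`!%:R)^-1 = (d`!%:R)^-1 :> F.
Proof. by rewrite factS natrM invfM mulVKf // pnatr_eq0. Qed.

Lemma monogenic_CK P : lowvar P -> monogenic (CK P).
Proof.
move=> Pl; apply/monogenicP => al; rewrite CK_lowvarE // incr_last shiftm_incr_last.
rewrite scalerA factS_inv iterS; set d := al last.
rewrite (@eq_emd_shiftm d (CK P) ((d`!%:R)^-1 *: iter d emd P)).
  by rewrite (linearZZ emd).
by move=> j jl; rewrite CK_lowvarE // incr_low.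
Qed.

Lemma restr_CK P : lowvar P -> restr (CK P) = P.
Proof.
move=> Pl; apply/funext=> al; rewrite /restr alastE; case: eqP => [al0|/eqP al0].
  by rewrite CK_lowvarE // al0 shiftm0 fact0 invr1 scale1r.
by move/lowvarP: Pl => ->.
Qed.

Lemma lowvar_restr P : lowvar (restr P).
Proof. by apply/lowvarP=> al al0; rewrite /restr alastE (negPf al0). Qed.

Lemma monogenic_restr_inj P Q : monogenic P -> monogenic Q -> restr P = restr Q -> P = Q.
Proof.
move=> /monogenicP PE /monogenicP QE PQ; apply/funext=> al.
have [d ald] : exists d, al last = d by exists (al last).
elim: d al ald => [|d IHd] al ald.
  by have := congr1 (fun R => R al) PQ; rewrite /restr alastE ald.
have [be alE] : exists be, al = incr last be.
  exists (shiftm 1 al); apply/ffunP=> i; rewrite !ffunE eq_last.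
  by case: eqP => [->|_]; rewrite ?addn0 // subnK // ald.
have bed : be last = d by move: ald; rewrite alE incr_last => -[].
have be_neq0 : (be last).+1%:R != 0 :> F by rewrite pnatr_eq0.
rewrite alE; apply: (scalerI be_neq0); rewrite PE QE -[be in RHS](shiftm0 be).
by apply: eq_emd_shiftm => j jl; rewrite shiftm0 IHd // incr_low.
Qed.

Lemma CK_restr P : monogenic P -> P = CK (restr P).
Proof.
move=> P0; apply: monogenic_restr_inj P0 (monogenic_CK (lowvar_restr P)) _.
by rewrite restr_CK //; exact: lowvar_restr.
Qed.

End CauchyKovalevskaya.

(** * Initial data *)

Section InitialData.
Variables (F : numFieldType) (n : nat).
Local Notation m := n.+1.
Local Notation last := (@ord_max n).
Local Notation clpoly := (mi m -> clifford F m).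
Implicit Types (P Q p u v : clpoly) (a b : clifford F m) (al : mi m) (A C : {set 'I_m}).
Implicit Types (i j : 'I_m) (s k d : nat) (t : int).

Definition ker_dplus t u := low_multivector t u /\ dplus u = 0.
Definition ker_dminus t v := low_multivector t v /\ dminus v = 0.

Lemma Pks_lowP k t P : Pks_low k t P <-> homog k P /\ low_multivector t P.
Proof.
split=> [[[Pk Pt] [Pl /lowalgP Pa]]|[Pk [Pl Pt]]]; split=> //; split=> //.
- by move=> al; rewrite blade_spanI Pa; apply/is_gradeP/Pt.
- by move=> al; apply/is_gradeP; exact: low_multivector_grade (conj Pl Pt).
- by apply/lowalgP => al; exact: low_multivector_low (conj Pl Pt).
Qed.

Lemma KerplusP k t u : Kerplus k t u <-> homog k u /\ ker_dplus t u.
Proof.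
split=> [[/Pks_lowP[uk ut] u0]|[uk [ut u0]]]; first by do 2!split=> //; apply/funext.
by split=> [|al]; [apply/Pks_lowP | rewrite u0].
Qed.

Lemma KerminusP k t v : Kerminus k t v <-> homog k v /\ ker_dminus t v.
Proof.
split=> [[/Pks_lowP[vk vt] v0]|[vk [vt v0]]]; first by do 2!split=> //; apply/funext.
by split=> [|al]; [apply/Pks_lowP | rewrite v0].
Qed.

Lemma emd_initial s u v : low_multivector s u -> low_multivector (s%:Z - 1) v ->
  emd (padd u (prmul v em)) =
  padd (pscale ((-1) ^+ s.+1) (dunder v)) (prmul (pscale ((-1) ^+ s.+1) (dunder u)) em).
Proof.
move=> us vs.
have -> : emd (padd u (prmul v em)) = padd (emd u) (emd (prmul v em)) by exact: linearD.
rewrite (emd_low us) (emd_low_mul_em vs) signz_subr1 prmulZ.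
have -> : s%:Z + 1 = s.+1 by rewrite -addn1 PoszD.
by rewrite -exprnP; exact: addrC.
Qed.

Lemma dunder_ker_dplus t u : ker_dplus t u -> dunder u = dminus u.
Proof. by move=> [_ u0]; rewrite dunder_split u0; exact: add0r. Qed.

Lemma dunder_ker_dminus t v : ker_dminus t v -> dunder v = dplus v.
Proof. by move=> [_ v0]; rewrite dunder_split v0; exact: addr0. Qed.

Lemma dminus_iter_pmd d P : dminus (iter d pmd P) = iter d mdp (dminus P).
Proof. by elim: d => [//|d IHd]; rewrite iterS [RHS]iterS -IHd. Qed.

Lemma dplus_iter_mdp d P : dplus (iter d mdp P) = iter d pmd (dplus P).
Proof. by elim: d => [//|d IHd]; rewrite iterS [RHS]iterS -IHd. Qed.

Lemma pscale_signK d P : pscale ((-1) ^+ d) (pscale ((-1) ^+ d) P) = P.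
Proof. by apply/funext=> al; rewrite /pscale !clscaleE scalerA -expr2 sqrr_sign scale1r. Qed.

Lemma useqS s u v d : useq s u v d.+1 = pscale ((-1) ^+ s.+1) (dplus (vseq s u v d)).
Proof.
rewrite /useq /vseq /= uphalf_half; case: (odd d) => /=; last by rewrite dplus_iter_mdp.
by rewrite dplusZ pscale_signK -dminus_iter_pmd.
Qed.

Lemma vseqS s u v d : vseq s u v d.+1 = pscale ((-1) ^+ s.+1) (dminus (useq s u v d)).
Proof.
rewrite /useq /vseq /= uphalf_half; case: (odd d) => /=; last by rewrite dminus_iter_pmd.
by rewrite dminusZ pscale_signK -dplus_iter_mdp.
Qed.

Lemma ker_dplus_useqS s u v d :
  ker_dminus (s%:Z - 1) (vseq s u v d) -> ker_dplus s (useq s u v d.+1).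
Proof.
move=> [vs _]; rewrite useqS; split.
  by apply: low_multivectorZ; rewrite -[s%:Z](subrK 1); exact: low_multivector_dplus.
by rewrite dplusZ dplus_dplus pscale0.
Qed.

Lemma ker_dminus_vseqS s u v d :
  ker_dplus s (useq s u v d) -> ker_dminus (s%:Z - 1) (vseq s u v d.+1).
Proof.
move=> [us _]; rewrite vseqS; split; first exact/low_multivectorZ/low_multivector_dminus.
by rewrite dminusZ dminus_dminus pscale0.
Qed.

Lemma iter_emd_initial s u v d : ker_dplus s u -> ker_dminus (s%:Z - 1) v ->
  [/\ iter d emd (padd u (prmul v em)) = padd (useq s u v d) (prmul (vseq s u v d) em),
      ker_dplus s (useq s u v d) & ker_dminus (s%:Z - 1) (vseq s u v d)].
Proof.
move=> u0 v0; elim: d => [//|d [IHd ud vd]]; split.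
- rewrite iterS IHd (emd_initial ud.1 vd.1).
  by rewrite (dunder_ker_dplus ud) (dunder_ker_dminus vd) useqS vseqS.
- exact: ker_dplus_useqS.
- exact: ker_dminus_vseqS.
Qed.

Lemma homogD_prmul k u v a : homog k u -> homog k v -> homog k (padd u (prmul v a)).
Proof.
move=> uk vk al; have [u0|/uk //] := eqVneq (u al) 0.
have [v0|/vk //] := eqVneq (v al) 0.
by rewrite /padd prmulE u0 v0 mul0r addr0 eqxx.
Qed.

Lemma lowvarD_prmul u v a : lowvar u -> lowvar v -> lowvar (padd u (prmul v a)).
Proof.
move=> /lowvarP ul /lowvarP vl; apply/lowvarP=> al al0.
by rewrite /padd prmulE ul // vl // mul0r addr0.
Qed.

Lemma CK_initial k s u v : Kerplus k s u -> Kerminus k (s%:Z - 1) v ->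
  CK (padd u (prmul v em)) = padd (series k (useq s u v)) (prmul (series k (vseq s u v)) em).
Proof.
move=> /KerplusP[uk u0] /KerminusP[vk v0]; rewrite (CK_homogE (homogD_prmul uk vk)).
apply/funext=> al; rewrite fct_sumE /padd prmulE mulr_suml -big_split.
apply: eq_bigr => d _ /=; have [-> _ _] := iter_emd_initial d u0 v0.
rewrite -!taylor_term_mulxm /taylor_term; case: ifP => _; last by rewrite mul0r addr0.
by rewrite scalerDr scalerAl.
Qed.

Lemma Ispace_lowvar k s p : Ispace k s p -> lowvar p.
Proof.
move=> [u [v [/KerplusP[_ u0] [/KerminusP[_ v0] ->]]]].
exact: lowvarD_prmul u0.1.1 v0.1.1.
Qed.

Lemma Ispace_homog k s p : Ispace k s p -> homog k p.
Proof. by move=> [u [v [/KerplusP[uk _] [/KerminusP[vk _] ->]]]]; exact: homogD_prmul. Qed.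

Lemma CK_Hks k s p : Ispace k s p -> Hks k s (CK p).
Proof.
move=> Ip; have pk := Ispace_homog Ip; have pl := Ispace_lowvar Ip.
have [u [v [/KerplusP[_ u0] [/KerminusP[_ v0] pE]]]] := Ip; split; last exact: monogenic_CK.
split=> [|al]; first exact: CK_homog.
apply/is_gradeP; rewrite CK_lowvarE //; apply: rpredZ; set d := al last.
rewrite pE; have [-> [ud _] [vd _]] := iter_emd_initial d u0 v0; set be := shiftm d al.
rewrite /padd prmulE emE [_ \in _]gradeD_mul_gen_last.
- by rewrite (low_multivector_grade be ud) (low_multivector_grade be vd).
- exact: low_multivector_low ud.
- exact: low_multivector_low vd.
Qed.

Lemma CK_Ispace_inj k s p q : Ispace k s p -> Ispace k s q -> CK p = CK q -> p = q.
Proof.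
move=> /Ispace_lowvar pl /Ispace_lowvar ql pq.
by rewrite -(restr_CK pl) -(restr_CK ql) pq.
Qed.

Lemma Ispace_of_emd k s p :
  Pks k s p -> lowvar p -> (forall al, emd p al \in blade_span (grade s)) -> Ispace k s p.
Proof.
move=> [pk ps] pl es; pose u := low_part \o p; pose v := top_part \o p.
have pE : p = padd u (prmul v em).
  by apply/funext=> al; rewrite [LHS]low_top_split /padd prmulE emE.
have uv_grade al : (u al \in blade_span (grade s)) && (v al \in blade_span (grade (s%:Z - 1))).
  rewrite -gradeD_mul_gen_last ?low_part_low ?top_part_low // -low_top_split.
  exact/is_gradeP/ps.
have us : low_multivector s u.
  split=> [|al]; first exact: lowvar_comp low_part0 pl.
  by rewrite blade_spanI low_part_low; have /andP[] := uv_grade al.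
have vs : low_multivector (s%:Z - 1) v.
  split=> [|al]; first exact: lowvar_comp top_part0 pl.
  by rewrite blade_spanI top_part_low; have /andP[] := uv_grade al.
have d_grade al : (dunder v al \in blade_span (grade s)) &&
    (dunder u al \in blade_span (grade (s%:Z - 1))).
  rewrite -(@rpredZsign _ (clifford F m) _ s.+1 (dunder v al)).
  rewrite -(@rpredZsign _ (clifford F m) _ s.+1 (dunder u al)).
  rewrite -gradeD_mul_gen_last; last 2 first.
  - exact/rpredZ/dunder_low/vs.
  - exact/rpredZ/dunder_low/us.
  by have := es al; rewrite pE (emd_initial us vs) /padd prmulE emE.
exists u, v; split; [|split=> //]; [apply/KerplusP|apply/KerminusP].
- split; first exact: homog_comp low_part0 pk.
  by split=> //; apply: dplus_eq0 us _ => al; case/andP: (d_grade al).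
- split; first exact: homog_comp top_part0 pk.
  by split=> //; apply: dminus_eq0 vs _ => al; rewrite subrK; case/andP: (d_grade al).
Qed.

Lemma Pks_restr k s p : Pks k s p -> Pks k s (restr p).
Proof.
move=> [pk ps]; split=> [al|al]; rewrite /restr; case: ifP => _; rewrite ?eqxx //.
- exact: pk.
- by apply/is_gradeP; exact: rpred0.
Qed.

Lemma Hks_restr k s p : Hks k s p -> Ispace k s (restr p) /\ p = CK (restr p).
Proof.
move=> [pks p0]; split; last exact: CK_restr.
have rl := lowvar_restr p; apply: Ispace_of_emd => //; first exact: Pks_restr.
move=> al; have [al0|al0] := eqVneq (al last) 0%N; last first.
  by rewrite (lowvarP _).1 ?rpred0 // emd_gradientE; exact: lowvar_low_gradient.
rewrite (@eq_emd_shiftm _ _ 0 _ p) => [|j jl]; rewrite !shiftm0; last first.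
  by rewrite /restr alastE incr_low // al0.
by rewrite -((monogenicP p).1 p0); apply: rpredZ; apply/is_gradeP/pks.2.
Qed.

End InitialData.

(** * Conjugation by the Pin group *)

Definition mxact {R : pzSemiRingType} {p q : nat} (L : 'M[R]_(p, q)) (x : 'I_q -> R) : 'I_p -> R :=
  fun i => \sum_j L i j * x j.

Lemma mxactM (R : comPzSemiRingType) p q r (K : 'M[R]_(p, q)) (L : 'M[R]_(q, r)) x :
  mxact (K *m L) x = mxact K (mxact L x).
Proof.
apply/funext=> i; rewrite /mxact; under eq_bigr => j _ do rewrite mxE mulr_suml.
rewrite exchange_big; apply: eq_bigr => l _; rewrite mulr_sumr.
by apply: eq_bigr => j _; rewrite mulrA.
Qed.

Lemma mxact1 (R : pzSemiRingType) p (x : 'I_p -> R) : mxact 1%:M x = x.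
Proof.
apply/funext=> i; rewrite /mxact (bigD1 i) //= mxE eqxx mul1r big1 ?addr0 // => j ji.
by rewrite mxE eq_sym (negPf ji) mul0r.
Qed.

Lemma mxact_delta (R : pzSemiRingType) p q (L : 'M[R]_(p, q)) j :
  mxact L (fun l => (l == j)%:R) = L ^~ j.
Proof.
apply/funext=> i; rewrite /mxact (bigD1 j) //= eqxx mulr1 big1 ?addr0 // => l /negPf->.
by rewrite mulr0.
Qed.

Lemma mxact_line (R : comPzSemiRingType) p q (L : 'M[R]_(p, q)) x v t :
  mxact L (fun l => x l + v l * t) = fun i => mxact L x i + mxact L v i * t.
Proof.
apply/funext=> i; rewrite /mxact mulr_suml -big_split.
by apply: eq_bigr => l _; rewrite mulrDr mulrA.
Qed.

Section PinConjugation.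
Variables (F : numFieldType) (n : nat).
Local Notation m := n.+1.
Local Notation last := (@ord_max n).
Implicit Types (r : clifford F m) (c x y : 'I_m -> F) (L K : 'M[F]_m) (i j : 'I_m).

(* [L] is the matrix of [x |-> r^-1 x r]; by the second equation its inverse is its transpose. *)
Definition intertwines L r : Prop :=
  [/\ forall x, vector x * r = r * vector (mxact L x),
      forall y, r * vector y = vector (mxact L^T y) * r
    & forall i, low i -> L i last = 0 /\ L last i = 0].

Lemma intertwines1 : intertwines 1%:M 1.
Proof.
split=> [x|y|i il]; rewrite ?trmx1 ?mxact1 ?mulr1 ?mul1r //.
by move: il; rewrite lowE !mxE [last == i]eq_sym => /negPf->.
Qed.

Lemma intertwinesM L K r r' :
  intertwines L r -> intertwines K r' -> intertwines (K *m L) (r * r').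
Proof.
move=> [Lr rL Ll] [Kr rK Kl]; split=> [x|y|i il].
- by rewrite mulrA Lr -!mulrA Kr mxactM.
- by rewrite -mulrA rK !mulrA rL trmx_mul mxactM.
rewrite !mxE; split; apply: big1 => j _; have [->|jl] := eqVneq j last.
- by rewrite (Kl i il).1 mul0r.
- by rewrite (Ll j _).1 ?mulr0 // lowE.
- by rewrite (Ll i il).2 mulr0.
- by rewrite (Kl j _).2 ?mul0r // lowE.
Qed.

Definition reflection c : 'M[F]_m := \matrix_(i, j) (2 * c i * c j - (i == j)%:R).

Lemma vector_reflection c x :
  vector (mxact (reflection c) x) = (2 * \sum_j c j * x j) *: vector c - vector x.
Proof.
rewrite !vectorE scaler_sumr -sumrB; apply: eq_bigr => i _; rewrite scalerA -scalerBl.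
congr (_ *: _); rewrite /mxact; under eq_bigr => j _ do rewrite mxE mulrBl.
rewrite sumrB mulr_sumr mulr_suml; congr (_ - _).
  by apply: eq_bigr => j _; ring.
by rewrite (bigD1 i) //= eqxx mul1r big1 ?addr0 // => j /negPf ji; rewrite eq_sym ji mul0r.
Qed.

Lemma intertwines_unit c : unitlow c -> intertwines (reflection c) (vector c).
Proof.
move=> [_ [cl c1]]; have cc : vector c * vector c = -1 by rewrite vector_sqr c1 scaleN1r.
have cl0 : c last = 0 by apply: cl; rewrite lowE eqxx.
have anti x := vector_anticomm c x.
split=> [x|y|i].
- rewrite vector_reflection mulrBr -scalerAr cc scalerN -scaleNr -(anti x).
  by rewrite addrAC subrr add0r.
- have -> : (reflection c)^T = reflection c.
    by apply/matrixP=> i j; rewrite !mxE eq_sym mulrAC.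
  by rewrite vector_reflection mulrBl -scalerAl cc scalerN -scaleNr -(anti y) addrK.
by rewrite lowE !mxE cl0 [last == i]eq_sym => /negPf->; rewrite !mulr0 mul0r subr0.
Qed.

Lemma pin_low_intertwines r : pin_low r -> exists L, intertwines L r.
Proof.
move=> [cs [csU ->]]; elim: cs csU => [|c cs IHcs] csU /=.
  by exists 1%:M; exact: intertwines1.
have [|K Kcs] := IHcs; first by move=> i ics; exact: (csU i.+1).
by exists (K *m reflection c); apply: intertwinesM Kcs; exact/intertwines_unit/(csU 0%N).
Qed.

Lemma coords_conj L r ri x : intertwines L r -> ri * r = 1 ->
  coords (ri * vector x * r) = mxact L x.
Proof. by move=> [Lr _ _] rir; rewrite -mulrA Lr mulrA rir mul1r coords_vector. Qed.

Lemma intertwines_gen_last L r : intertwines L r -> gen last * r = L last last *: (r * gen last).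
Proof.
move=> [Lr _ Ll]; rewrite -vector_delta Lr mxact_delta scalerAr; congr (_ * _).
rewrite vectorE (bigD1 last) //= big1 ?addr0 ?vector_delta // => i.
by rewrite -lowE => /Ll[-> _]; rewrite scale0r.
Qed.

Lemma intertwines_mxact_last L r x : intertwines L r -> mxact L x last = L last last * x last.
Proof.
move=> [_ _ Ll]; rewrite /mxact (bigD1 last) //= big1 ?addr0 // => j.
by rewrite -lowE => /Ll[_ ->]; rewrite mul0r.
Qed.

Lemma intertwines_mul_gen L r i : intertwines L r -> r * gen i = vector (L i) * r.
Proof.
move=> [_ rL _]; rewrite -vector_delta rL mxact_delta; congr (vector _ * _).
by apply/funext=> j; rewrite mxE.
Qed.

End PinConjugation.

(** * Evaluation and the H-action *)

Lemma poly_eq_horner (R : numDomainType) (p q : {poly R}) : (forall t, p.[t] = q.[t]) -> p = q.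
Proof.
move=> pq; apply/eqP; rewrite -subr_eq0; apply/eqP.
pose naturals := [seq l%:R : R | l <- iota 0 (size (p - q))].
apply: (@roots_geq_poly_eq0 _ _ naturals).
- by apply/allP=> t _; rewrite /root hornerD hornerN pq addrN.
- by rewrite map_inj_uniq ?iota_uniq // => l l' /eqP; rewrite eqr_nat => /eqP.
- by rewrite size_map size_iota.
Qed.

Lemma deriv_prod (R : comNzRingType) (I : finType) (f : I -> {poly R}) :
  (\prod_i f i)^`() = \sum_j (f j)^`() * \prod_(i | i != j) f i.
Proof.
suff deriv_prod_seq (r : seq I) : uniq r ->
    (\prod_(i <- r) f i)^`() = \sum_(j <- r) (f j)^`() * \prod_(i <- r | i != j) f i.
  exact/deriv_prod_seq/index_enum_uniq.
elim: r => [_|l r IHr /= /andP[lr /IHr{}IHr]]; first by rewrite !big_nil derivC.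
rewrite !big_cons derivM IHr eqxx /= mulr_sumr; congr (_ * _ + _).
  rewrite big_seq [RHS]big_seq_cond; apply: eq_bigl => i.
  by case: (boolP (i \in r)) => //= ir; apply/esym; apply: contraNneq lr => <-.
rewrite big_seq [RHS]big_seq; apply: eq_bigr => j jr.
rewrite big_cons ifT; first exact: mulrCA.
by apply: contraNneq lr => ->.
Qed.

Section Evaluation.
Variables (F : numFieldType) (m k : nat).
Local Notation clpoly := (mi m -> clifford F m).
Local Notation box := {ffun 'I_m -> 'I_k.+1}.
Implicit Types (P Q : clpoly) (al : mi m) (x v : 'I_m -> F) (i j : 'I_m) (b : box).

Definition box_index b : mi m := [ffun i => val (b i)].

Definition monomial x al : F := \prod_i x i ^+ al i.

(* Unlike [peval k], this evaluates every polynomial of degree at most [k], which makes it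
   stable under differentiation. *)
Definition eval_le x P : clifford F m :=
  \sum_(b : box) monomial x (box_index b) *: P (box_index b).

Fact eval_le_linear x : linear (eval_le x).
Proof.
move=> c P Q; rewrite /eval_le scaler_sumr -big_split; apply: eq_bigr => b _ /=.
by rewrite fctE scalerDr !scalerA [_ * c]mulrC.
Qed.

HB.instance Definition _ x :=
  GRing.isLinear.Build F clpoly (clifford F m) *:%R (eval_le x) (eval_le_linear x).

Lemma eval_le_comp (T : {linear clifford F m -> clifford F m}) P x :
  eval_le x (T \o P) = T (eval_le x P).
Proof. by rewrite /eval_le linear_sum; apply: eq_bigr => b _; rewrite linearZZ. Qed.

Lemma peval_homog P x : homog k P -> peval k P x = eval_le x P.
Proof.
move=> Pk; rewrite /peval big_mkcond; apply: eq_bigr => b _.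
have monoE : monomial x (box_index b) = \prod_i x i ^+ b i.
  by apply: eq_bigr => i _; rewrite ffunE.
rewrite monoE -/(box_index b); case: ifPn => // bk.
have [->|/Pk degb] := eqVneq (P (box_index b)) 0; first by rewrite scaler0.
by case/eqP: bk; rewrite -[RHS]degb; apply: eq_bigr => i _; rewrite ffunE.
Qed.

Lemma sum_box_incr (V : nmodType) (g : mi m -> V) j :
    (forall al, (k < mdeg al)%N -> g al = 0) -> (forall al, al j = 0%N -> g al = 0) ->
  \sum_b g (box_index b) = \sum_b g (incr j (box_index b)).
Proof.
move=> gk g0; pose cycle_j b : box := [ffun i => if i == j then ordS (b i) else b i].
have cycle_j_inj : injective cycle_j.
  move=> b b' /ffunP bb'; apply/ffunP=> i; have := bb' i; rewrite !ffunE.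
  by case: ifP => // _ /ordS_inj.
rewrite (reindex_inj cycle_j_inj); apply: eq_bigr => b _.
have [bk|kb] := ltnP (b j) k.
  congr g; apply/ffunP=> i; rewrite !ffunE; case: eqP => [->|_]; last by rewrite addn0.
  by rewrite /= modn_small ?addn1.
(* The terms that wrap around vanish on both sides. *)
have bjk : b j = k :> nat by apply/eqP; rewrite eqn_leq kb -ltnS ltn_ord.
rewrite g0 ?gk //.
  by rewrite mdeg_incr ltnS /mdeg (bigD1 j) //= ffunE (leq_trans kb) // leq_addr.
by rewrite !ffunE eqxx /= bjk modnn.
Qed.

Definition degree_le P : Prop := forall al, (k < mdeg al)%N -> P al = 0.

Definition line_monomial x v al : {poly F} := \prod_i ((x i)%:P + v i *: 'X) ^+ al i.

Definition line_poly x v (f : mi m -> F) : {poly F} :=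
  \sum_b f (box_index b) *: line_monomial x v (box_index b).

Lemma horner_line_monomial x v al t :
  (line_monomial x v al).[t] = monomial (fun i => x i + v i * t) al.
Proof.
rewrite /line_monomial horner_prod; apply: eq_bigr => i _.
by rewrite horner_exp hornerD hornerZ hornerX hornerC.
Qed.

Lemma horner_line_poly x v P A t :
  (line_poly x v (fun al => P al A)).[t] = eval_le (fun i => x i + v i * t) P A.
Proof.
rewrite /line_poly /eval_le sum_ffunE horner_sum; apply: eq_bigr => b _.
by rewrite hornerZ ffunE horner_line_monomial mulrC.
Qed.

Lemma deriv_line_monomial x v al :
  (line_monomial x v al)^`().[0] =
  \sum_j v j * ((al j)%:R * monomial x (decr j al)).
Proof.
have line0 i : ((x i)%:P + v i *: 'X).[0] = x i.
  by rewrite hornerD hornerZ hornerX hornerC mulr0 addr0.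
rewrite deriv_prod horner_sum; apply: eq_bigr => j _.
rewrite deriv_exp derivD derivZ derivX derivC add0r alg_polyC hornerM hornerMn hornerM hornerC.
rewrite horner_exp line0 horner_prod /monomial [in RHS](bigD1 j) //= ffunE eqxx subn1.
have -> : \prod_(i | i != j) (((x i)%:P + v i *: 'X) ^+ al i).[0] =
    \prod_(i | i != j) x i ^+ decr j al i.
  by apply: eq_bigr => i /negPf ij; rewrite horner_exp line0 ffunE ij subn0.
by rewrite -[_ *+ _]mulr_natl; ring.
Qed.

Lemma deriv_line_poly x v P A : degree_le P ->
  (line_poly x v (fun al => P al A))^`().[0] = \sum_j v j * eval_le x (pderiv j P) A.
Proof.
move=> Pk; rewrite /line_poly (raddf_sum (@deriv F)) /= horner_sum.
transitivity (\sum_b \sum_j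
    P (box_index b) A * (v j * ((box_index b j)%:R * monomial x (decr j (box_index b))))).
  by apply: eq_bigr => b _; rewrite derivZ hornerZ deriv_line_monomial mulr_sumr.
rewrite exchange_big; apply: eq_bigr => j _ /=.
pose g al : F := P al A * (v j * ((al j)%:R * monomial x (decr j al))).
rewrite (@sum_box_incr _ g j) => [|al alk|al al0]; rewrite /g; last 2 first.
- by rewrite Pk // ffunE mul0r.
- by rewrite al0 mul0r !mulr0.
rewrite /eval_le sum_ffunE mulr_sumr; apply: eq_bigr => b _.
rewrite incrE eqxx addn1 incrK.
by rewrite pderivE !coef_scale; ring.
Qed.

(* Both sides are the linear terms of one polynomial along the line through [x] in direction [j]. *)
Lemma eval_le_pderiv_mxact (L : 'M[F]_m) P Q : degree_le P -> degree_le Q ->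
  (forall x, eval_le x Q = eval_le (mxact L x) P) ->
  forall x j, eval_le x (pderiv j Q) = \sum_i L i j *: eval_le (mxact L x) (pderiv i P).
Proof.
move=> Pk Qk PQ x j; apply/ffunP=> A.
have lineE : line_poly x (fun i => (i == j)%:R) (fun al => Q al A) =
    line_poly (mxact L x) (L ^~ j) (fun al => P al A).
  apply: poly_eq_horner => t; rewrite !horner_line_poly PQ.
  by rewrite mxact_line mxact_delta.
have := congr1 (fun f : {poly F} => f^`().[0]) lineE.
rewrite !deriv_line_poly // (bigD1 j) //= eqxx mul1r big1 ?addr0 => [->|i /negPf->].
  by rewrite sum_ffunE; apply: eq_bigr => i _; rewrite coef_scale.
by rewrite mul0r.
Qed.

Lemma sum_box_iter_incr (V : nmodType) (g : mi m -> V) j d :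
    (forall al, (k < mdeg al)%N -> g al = 0) -> (forall al, (al j < d)%N -> g al = 0) ->
  \sum_b g (box_index b) = \sum_b g (iter d (incr j) (box_index b)).
Proof.
elim: d g => [//|d IHd] g gk g0.
rewrite (@sum_box_incr _ g j) // => [|al al0]; last by rewrite g0 ?al0.
apply: (IHd (g \o incr j)) => al /= ald; [apply: gk | apply: g0].
  by rewrite mdeg_incr ltnW.
by rewrite incrE eqxx addn1.
Qed.

Lemma monomial_iter_incr x j d al : monomial x (iter d (incr j) al) = x j ^+ d * monomial x al.
Proof.
elim: d => [|d IHd]; first by rewrite mul1r.
rewrite iterS exprS -mulrA -IHd /monomial (bigD1 j) //= [in RHS](bigD1 j) //=.
rewrite incrE eqxx addn1 exprS -mulrA; congr (_ * (_ * _)).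
by apply: eq_bigr => i /negPf ij; rewrite incrE ij addn0.
Qed.

End Evaluation.

Section Equivariance.
Variables (F : numFieldType) (n k : nat).
Local Notation m := n.+1.
Local Notation last := (@ord_max n).
Local Notation clpoly := (mi m -> clifford F m).
Local Notation eval := (eval_le k).
Implicit Types (P Q : clpoly) (r ri : clifford F m) (al : mi m) (x : 'I_m -> F).
Implicit Types (L : 'M[F]_m) (d : nat).

Lemma eval_emd P x :
  eval x (emd P) = gen last * \sum_(j | low j) gen j * eval x (pderiv j P).
Proof.
have -> : emd P = (gen last \*o idfun) \o (\sum_(j | low j) ((gen j \*o idfun) \o pderiv j P)).
  by apply/funext=> al; rewrite /= fct_sumE.
rewrite eval_le_comp (linear_sum (eval x)); congr (_ * _).
by apply: eq_bigr => j _; exact: eval_le_comp.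
Qed.

Definition sandwich r ri (a : clifford F m) : clifford F m := r * a * ri.

Fact sandwich_linear r ri : linear (sandwich r ri).
Proof. by move=> x a b; rewrite /sandwich mulrDr mulrDl -scalerAr -scalerAl. Qed.

HB.instance Definition _ r ri := GRing.isLinear.Build F (clifford F m) (clifford F m)
  *:%R (sandwich r ri) (sandwich_linear r ri).

Definition transported L r ri P Q : Prop :=
  forall x, eval x Q = sandwich r ri (eval (mxact L x) P).

Lemma transported_pderiv L r ri P Q :
    degree_le k P -> degree_le k Q -> transported L r ri P Q ->
  forall x j, eval x (pderiv j Q) =
    \sum_i L i j *: sandwich r ri (eval (mxact L x) (pderiv i P)).
Proof.
move=> Pk Qk PQ x j; pose T : {linear _ -> _} := sandwich r ri.
rewrite (@eval_le_pderiv_mxact F m k L (T \o P)) //.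
- by apply: eq_bigr => i _; rewrite pderiv_comp eval_le_comp.
- by move=> al /Pk PE; rewrite /= PE linear0.
- by move=> y; rewrite PQ eval_le_comp.
Qed.

Lemma intertwines_low_sum L r (X : 'I_m -> clifford F m) : intertwines L r ->
  \sum_(j | low j) gen j * \sum_i L i j *: (r * X i) = r * \sum_(i | low i) gen i * X i.
Proof.
move=> Lr; have [_ _ Ll] := Lr.
under eq_bigr => j _ do rewrite mulr_sumr.
rewrite exchange_big mulr_sumr [RHS]big_mkcond; apply: eq_bigr => i _ /=.
have sumE : \sum_(j | low j) gen j * (L i j *: (r * X i)) =
    (\sum_(j | low j) L i j *: gen j) * r * X i.
  by rewrite -mulrA mulr_suml; apply: eq_bigr => j _; rewrite -scalerAl -scalerAr.
rewrite sumE; case: ifPn => [il|]; last first.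
  rewrite lowE negbK => /eqP->; rewrite big1 ?mul0r // => j /Ll[_ ->].
  by rewrite scale0r.
rewrite mulrA (intertwines_mul_gen i Lr) vectorE [in RHS](bigD1 last) //=.
by rewrite (Ll i il).1 scale0r add0r; under [in RHS]eq_bigl do rewrite -lowE.
Qed.

Lemma transported_emd L r ri P Q :
    intertwines L r -> degree_le k P -> degree_le k Q ->
  transported L r ri P Q -> transported L r ri (L last last *: emd P) (emd Q).
Proof.
move=> Lr Pk Qk PQ x; rewrite (linearZZ (eval _)) (linearZZ (sandwich r ri)) /= !eval_emd.
under eq_bigr => j _ do rewrite (transported_pderiv Pk Qk PQ).
pose X i := eval (mxact L x) (pderiv i P).
have -> : \sum_(j | low j) gen j * (\sum_i L i j *: sandwich r ri (X i)) =
    (\sum_(j | low j) gen j * (\sum_i L i j *: (r * X i))) * ri.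
  rewrite mulr_suml; apply: eq_bigr => j _; rewrite -mulrA mulr_suml; congr (_ * _).
  by apply: eq_bigr => i _; rewrite -scalerAl.
rewrite (intertwines_low_sum _ Lr) /sandwich !mulrA (intertwines_gen_last Lr).
by rewrite -!scalerAl.
Qed.

Lemma degree_le_iter_emd d P : degree_le k P -> degree_le k (iter d emd P).
Proof.
move=> Pk; elim: d => // d IHd al alk; apply: contraTeq alk => /emd_neq0[j _].
by apply: contraNN => alk; apply/eqP/IHd; rewrite mdeg_incr ltnW.
Qed.

Lemma transported_iter_emd L r ri P Q d :
    intertwines L r -> degree_le k P -> degree_le k Q ->
    transported L r ri P Q ->
  transported L r ri (L last last ^+ d *: iter d emd P) (iter d emd Q).
Proof.
move=> Lr Pk Qk PQ; elim: d => [|d IHd]; first by rewrite scale1r.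
have dPk : degree_le k (L last last ^+ d *: iter d emd P).
  by move=> al alk; rewrite fctE degree_le_iter_emd // scaler0.
have := transported_emd Lr dPk (degree_le_iter_emd d Qk) IHd.
by rewrite (linearZZ emd) scalerA -exprS.
Qed.

Lemma taylor_term_iter_incr d P al :
  taylor_term d P (iter d (incr last) al) = (d`!%:R)^-1 *: P al.
Proof.
have iter_last e : iter e (incr last) al last = (al last + e)%N.
  by elim: e => [|e IHe]; rewrite ?addn0 // iterS incr_last IHe addnS.
have shift_iter e : shiftm e (iter e (incr last) al) = al.
  by elim: e => [|e IHe]; rewrite ?shiftm0 // iterS shiftm_incr_last.
by rewrite /taylor_term iter_last leq_addl shift_iter.
Qed.

Lemma eval_taylor_term d P x : (forall al, P al != 0 -> (mdeg al + d)%N = k) ->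
  eval x (taylor_term d P) = ((d`!%:R)^-1 * x last ^+ d) *: eval x P.
Proof.
move=> Pk; pose g al := monomial x al *: taylor_term d P al.
rewrite -[LHS]/(\sum_b g (box_index b)) (@sum_box_iter_incr _ _ _ g last d).
- rewrite scaler_sumr; apply: eq_bigr => b _.
  by rewrite /g monomial_iter_incr taylor_term_iter_incr !scalerA mulrAC [_ * (_)^-1]mulrC.
- move=> al alk; apply: contraTeq alk; rewrite /g => nz.
  have /(taylor_term_homog Pk) <- : taylor_term d P al != 0.
    by apply: contraNN nz => /eqP->; rewrite scaler0.
  by rewrite ltnn.
- by move=> al ald; rewrite /g /taylor_term leqNgt ald scaler0.
Qed.

Lemma eval_CK P x : homog k P ->
  eval x (CK P) = \sum_(d < k.+1) ((d`!%:R)^-1 * x last ^+ d) *: eval x (iter d emd P).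
Proof.
move=> Pk; rewrite (CK_homogE Pk) (linear_sum (eval x)); apply: eq_bigr => d _.
by apply: eval_taylor_term => al; exact: mdeg_iter_emd.
Qed.

Lemma homog_degree_le P : homog k P -> degree_le k P.
Proof. by move=> Pk al; apply: contraTeq => /Pk <-; rewrite ltnn. Qed.

Lemma CK_equivariant r ri P Q : pin_low r -> ri * r = 1 -> homog k P -> homog k Q ->
  (forall x, peval k Q x = hact_at k r ri P x) ->
  forall x, peval k (CK Q) x = hact_at k r ri (CK P) x.
Proof.
move=> /pin_low_intertwines[L Lr] rir Pk Qk PQ x.
have hactE R y : homog k R -> hact_at k r ri R y = sandwich r ri (eval (mxact L y) R).
  by move=> Rk; rewrite -(coords_conj y Lr rir) -peval_homog.
have LPQ : transported L r ri P Q.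
  by move=> y; rewrite -hactE // -peval_homog //; exact: PQ.
rewrite hactE ?peval_homog; try exact: CK_homog.
rewrite !eval_CK // linear_sum; apply: eq_bigr => d _.
rewrite (transported_iter_emd d Lr (homog_degree_le Pk) (homog_degree_le Qk) LPQ).
rewrite (intertwines_mxact_last x Lr) (linearZZ (eval _)) !(linearZZ (sandwich r ri)).
by rewrite scalerA exprMn [L last last ^+ d * _]mulrC mulrA.
Qed.

End Equivariance.

Theorem theorem2 (F : numFieldType) (m s k : nat) :
  (2 <= m)%N -> (s <= m)%N ->
  (* (i) CK maps I_k^s into H_k^s *)
  (forall p0 : cpoly F m, Ispace k s p0 -> Hks k s (CK p0)) /\
  (* CK is linear on I_k^s *)
  (forall (p0 q0 : cpoly F m) (a b : F), Ispace k s p0 -> Ispace k s q0 ->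
     CK (padd (pscale a p0) (pscale b q0)) = padd (pscale a (CK p0)) (pscale b (CK q0))) /\
  (* injective on I_k^s *)
  (forall p0 q0 : cpoly F m, Ispace k s p0 -> Ispace k s q0 -> CK p0 = CK q0 -> p0 = q0) /\
  (* intertwines the H-action of Pin(m-1) *)
  (forall (r rinv : Cl F m), pin_low r -> clmul r rinv = clone -> clmul rinv r = clone ->
     forall p0 q0 : cpoly F m, Ispace k s p0 -> homog k q0 ->
     (forall x, peval k q0 x = hact_at k r rinv p0 x) ->
     forall x, peval k (CK q0) x = hact_at k r rinv (CK p0) x) /\
  (* (ii) explicit formula *)
  (forall u0 v0 : cpoly F m, Kerplus k s u0 -> Kerminus k (s%:Z - 1) v0 ->
     CK (padd u0 (prmul v0 em)) =
     padd (series k (useq s u0 v0)) (prmul (series k (vseq s u0 v0)) em)) /\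
  (* restriction lies in I_k^s and p = CK(p0); hence CK is onto H_k^s *)
  (forall p : cpoly F m, Hks k s p -> Ispace k s (restr p) /\ p = CK (restr p)).
Proof.
case: m => [//|n] _ _; split; first by move=> p0; exact: CK_Hks.
split; first by move=> p0 q0 a b _ _; exact: CK_linear_combination.
split; first exact: CK_Ispace_inj.
split; last by split; [exact: CK_initial | exact: Hks_restr].
move=> r ri rP _ rir p0 q0 Ip hq; apply: CK_equivariant => //.
exact: Ispace_homog Ip.
Qed.
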